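(* Let $I\subseteq F\{U\}$ and $J\subseteq F\{V\}$ be characterizable differential ideals (in differential polynomial rings over the same differential field $F$ with the same derivations $\Delta$, $|\Delta|=n$), and suppose there is a differential birational map from $F\{U\}/I$ to $F\{V\}/J$. Then the differential dimension polynomials $\omega_I$ and $\omega_J$ have the same degree $d$, and, writing $\omega_I(\ell)=\sum_{i=0}^n a_i\binom{\ell+i}{i}$ and $\omega_J(\ell)=\sum_{i=0}^n b_i\binom{\ell+i}{i}$ with integer coefficients, $a_i=b_i$ for all $i\ge d$.
   Context: $F$ is a differential field of characteristic zero with $n$ pairwise commuting derivations $\Delta=\{\partial_1,\dots,\partial_n\}$; $F\{U\}$ (resp. $F\{V\}$) is the differential polynomial ring in finitely many differential indeterminates $U$ (resp. $V$), i.e. the polynomial ring in all derivatives $\partial^\mu u$ ($u\in U$, $\mu\in\mathbb{Z}_{\ge0}^n$); $F\{U\}_{\le\ell}$ is the subring of polynomials in derivatives of order $|\mu|\le\ell$, and $I_{\le\ell}:=I\cap F\{U\}_{\le\ell}$. Characterizable differential ideal: a differential ideal of the form $\mathcal{I}(S)=\langle S\rangle_\Delta:(\mathrm{ini}(S)\cup\mathrm{sep}(S))^\infty$ with $S$ a differential regular chain with respect to an orderly ranking (a finite weakly triangular coherent set such that for each leader $x$ the initial and separant of $S_x$ are not zero divisors modulo $\mathcal{I}(S_{<x})$). The differential dimension polynomial $\omega_I$ is the numerical polynomial that agrees with $\ell\mapsto\dim(F\{U\}_{\le\ell}/I_{\le\ell})$ (Krull dimension) for all large $\ell$. For a commutative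 ring $R$, $\mathrm{quot}(R)$ denotes its total quotient ring. A differential birational map from $R=F\{U\}/I$ to $R'=F\{V\}/J$ is an $F$-algebra isomorphism $\mathrm{quot}(R)\to\mathrm{quot}(R')$ commuting with the derivations. *)

(* Defs.v *)
From HB Require Import structures.
From mathcomp Require Import all_boot all_order all_algebra.
From mathcomp Require Import finmap.
From mathcomp Require Import monalg.

Set Implicit Arguments.
Unset Strict Implicit.
Unset Printing Implicit Defensive.

Import Order.TTheory GRing.Theory Num.Theory.
Local Open Scope ring_scope.

Section DiffAlg.

Variables (F : fieldType) (n : nat).

Definition is_diff_field (der : 'I_n -> F -> F) : Prop :=
  [/\ [pchar F] =i pred0,
      (forall i x y, der i (x + y) = der i x + der i y),
      (forall i x y, der i (x * y) = der i x * y + x * der i y) &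
      (forall i j x, der i (der j x) = der j (der i x))].

Variable der : 'I_n -> F -> F.

(* Derivatives  d^mu u  of the m differential indeterminates u : 'I_m *)
Definition dvar (m : nat) := ('I_m * {ffun 'I_n -> nat})%type.

Variable m : nat.

Definition ordv (x : dvar m) : nat := (\sum_(i < n) x.2 i)%N.

Definition shiftv (i : 'I_n) (x : dvar m) : dvar m :=
  (x.1, [ffun j => (x.2 j + (j == i))%N]).

Definition is_derivative_of (x y : dvar m) : Prop :=
  x.1 = y.1 /\ forall j, (y.2 j <= x.2 j)%N.

(* the differential polynomial ring F{U}, U of cardinality m *)
Definition DP := {malg F[{cmonom (dvar m)}]}.

Definition Xv (x : dvar m) : DP := << ucm x >>.

Definition dmon (i : 'I_n) (k : {cmonom (dvar m)}) : DP :=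
  \sum_(x <- finsupp k) ((k x)%:R * << divcm k (ucm x) >> * Xv (shiftv i x)).

Definition dder (i : 'I_n) (p : DP) : DP :=
  \sum_(k <- msupp p) (<< der i p@_k *g k >> + p@_k *: dmon i k).

Definition dop (mu : {ffun 'I_n -> nat}) (p : DP) : DP :=
  foldr (fun i q => iter (mu i) (dder i) q) p (enum 'I_n).

Definition is_ideal (I : DP -> Prop) : Prop :=
  [/\ I 0, (forall p q, I p -> I q -> I (p + q)) &
      (forall r p, I p -> I (r * p))].

Definition is_dideal (I : DP -> Prop) : Prop :=
  is_ideal I /\ forall i p, I p -> I (dder i p).

Definition ideal_gen (A : DP -> Prop) : DP -> Prop :=
  fun p => forall J, is_ideal J -> (forall a, A a -> J a) -> J p.

Definition dideal_gen (A : DP -> Prop) : DP -> Prop :=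
  fun p => forall J, is_dideal J -> (forall a, A a -> J a) -> J p.

Definition mclos (H : DP -> Prop) (h : DP) : Prop :=
  exists l : seq DP, (forall x, x \in l -> H x) /\ h = \prod_(x <- l) x.

Definition saturation (J H : DP -> Prop) : DP -> Prop :=
  fun p => exists h, mclos H h /\ J (h * p).

Definition is_orderly_ranking (rk : rel (dvar m)) : Prop :=
  [/\ irreflexive rk, transitive rk,
      (forall x y, x != y -> rk x y || rk y x) &
      [/\ (forall i x, rk x (shiftv i x)),
       (forall i x y, rk x y -> rk (shiftv i x) (shiftv i y)) &
       (forall x y, (ordv x < ordv y)%N -> rk x y)]].

Variable rk : rel (dvar m).

Definition occurs (p : DP) (x : dvar m) : Prop :=
  exists2 k, k \in msupp p & x \in finsupp k.

Definition leader (p : DP) (x : dvar m) : Prop :=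
  occurs p x /\ forall y, occurs p y -> y = x \/ rk y x.

Definition degx (p : DP) (x : dvar m) : nat := (\max_(k <- msupp p) k x)%N.

Definition initial (p : DP) (x : dvar m) : DP :=
  \sum_(k <- msupp p | k x == degx p x)
     << p@_k *g divcm k (expcmn (ucm x) (k x)) >>.

Definition separant (p : DP) (x : dvar m) : DP :=
  \sum_(k <- msupp p) << (k x)%:R * p@_k *g divcm k (ucm x) >>.

Definition HA (A : DP -> Prop) : DP -> Prop :=
  fun h => exists s x, [/\ A s, leader s x & (h = initial s x \/ h = separant s x)].

Definition IS (A : DP -> Prop) : DP -> Prop :=
  saturation (dideal_gen A) (HA A).

Definition weakly_triangular (S : seq DP) : Prop :=
  (forall s, s \in S -> exists x, leader s x) /\
  (forall a b ua ub, a \in S -> b \in S -> a != b ->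
     leader a ua -> leader b ub -> ~ is_derivative_of ua ub).

Definition lcmv (x y : dvar m) : {ffun 'I_n -> nat} :=
  [ffun j => maxn (x.2 j) (y.2 j)].

Definition subv (w : {ffun 'I_n -> nat}) (x : dvar m) : {ffun 'I_n -> nat} :=
  [ffun j => (w j - x.2 j)%N].

Definition coherent (S : seq DP) : Prop :=
  forall a b ua ub, a \in S -> b \in S -> leader a ua -> leader b ub ->
    ua.1 = ub.1 ->
    let w := lcmv ua ub in
    let Delta := separant b ub * dop (subv w ua) a
                 - separant a ua * dop (subv w ub) b in
    saturation
      (ideal_gen (fun q => exists c uc (th : {ffun 'I_n -> nat}),
          [/\ c \in S, leader c uc,
              rk (uc.1, [ffun j => (uc.2 j + th j)%N]) (ua.1, w)
            & q = dop th c]))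
      (HA (fun s => s \in S)) Delta.

Definition nzd_mod (I : DP -> Prop) (p : DP) : Prop :=
  forall q, I (p * q) -> I q.

Definition S_lt (S : seq DP) (x : dvar m) : DP -> Prop :=
  fun s => s \in S /\ exists y, leader s y /\ rk y x.

Definition diff_regular_chain (S : seq DP) : Prop :=
  [/\ weakly_triangular S, coherent S &
      forall s x, s \in S -> leader s x ->
        nzd_mod (IS (S_lt S x)) (initial s x) /\
        nzd_mod (IS (S_lt S x)) (separant s x)].

End DiffAlg.

Section Charac.
Variables (F : fieldType) (n : nat) (der : 'I_n -> F -> F) (m : nat).

Local Notation DP := (DP F n m).

Definition characterizable (I : DP -> Prop) : Prop :=
  exists (rk : rel (dvar n m)) (S : seq DP),
    [/\ is_orderly_ranking rk, diff_regular_chain der rk S &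
        forall p, I p <-> IS der rk (fun s => s \in S) p].

Definition ord_le (l : nat) (p : DP) : Prop :=
  forall k, k \in msupp p -> forall x, x \in finsupp k -> (ordv x <= l)%N.

(* Krull dimension of S/J, S a subring of F{U} and J an ideal of S:
   suprema of lengths of chains of prime ideals of S containing J *)
Definition is_subideal (S P : DP -> Prop) : Prop :=
  [/\ (forall p, P p -> S p), P 0, (forall p q, P p -> P q -> P (p + q)) &
      (forall r p, S r -> P p -> P (r * p))].

Definition is_subprime (S P : DP -> Prop) : Prop :=
  [/\ is_subideal S P, ~ P 1 &
      forall a b, S a -> S b -> P (a * b) -> P a \/ P b].

Definition krull_chain (S J : DP -> Prop) (d : nat) : Prop :=
  exists c : nat -> DP -> Prop,
    (forall k, (k <= d)%N -> is_subprime S (c k) /\ forall p, J p -> c k p) /\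
    (forall k, (k < d)%N ->
       (forall p, c k p -> c k.+1 p) /\ exists p, c k.+1 p /\ ~ c k p).

Definition krull_dim (S J : DP -> Prop) (d : nat) : Prop :=
  krull_chain S J d /\ ~ krull_chain S J d.+1.

Definition is_dim_poly (I : DP -> Prop) (p : {poly rat}) : Prop :=
  exists N, forall l, (N <= l)%N ->
    exists d : nat, krull_dim (ord_le l) (fun q => I q /\ ord_le l q) d /\
                    p.[l%:R] = d%:R.

(* elements of quot(F{U}/I): fractions a/s, s not a zero divisor mod I *)
Definition dfrac := (DP * DP)%type.
Definition frac_ok (I : DP -> Prop) (x : dfrac) : Prop := nzd_mod I x.2.
Definition frac_eq (I : DP -> Prop) (x y : dfrac) : Prop := I (x.1 * y.2 - y.1 * x.2).
Definition frac_add (x y : dfrac) : dfrac := (x.1 * y.2 + y.1 * x.2, x.2 * y.2).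
Definition frac_mul (x y : dfrac) : dfrac := (x.1 * y.1, x.2 * y.2).
Definition frac_scale (c : F) (x : dfrac) : dfrac := (c *: x.1, x.2).
Definition frac_one : dfrac := (1, 1).
Definition frac_der (i : 'I_n) (x : dfrac) : dfrac :=
  (dder der i x.1 * x.2 - x.1 * dder der i x.2, x.2 * x.2).

End Charac.

(* binomial polynomial  l |-> C(l + i, i) *)
Definition binpoly (i : nat) : {poly rat} :=
  \prod_(j < i) (('X + (j.+1)%:R%:P) * ((j.+1)%:R^-1)%:P).

(* differential birational map F{U}/I --> F{V}/J: an F-algebra isomorphism
   quot(F{U}/I) -> quot(F{V}/J) commuting with the derivations, presented on
   representatives (fractions) of the total quotient rings *)
Definition diff_birational (F : fieldType) (n : nat) (der : 'I_n -> F -> F)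
  (m k : nat) (I : DP F n m -> Prop) (J : DP F n k -> Prop)
  (phi : dfrac F n m -> dfrac F n k) : Prop :=
  let okI := frac_ok I in let okJ := frac_ok J in
  let eI := frac_eq I in let eJ := frac_eq J in
  [/\ (forall x, okI x -> okJ (phi x)),
      (forall x y, okI x -> okI y -> eI x y <-> eJ (phi x) (phi y)),
      (forall y, okJ y -> exists2 x, okI x & eJ (phi x) y),
      (forall x y, okI x -> okI y ->
         eJ (phi (frac_add x y)) (frac_add (phi x) (phi y)) /\
         eJ (phi (frac_mul x y)) (frac_mul (phi x) (phi y))) &
      [/\ (forall c x, okI x -> eJ (phi (frac_scale c x)) (frac_scale c (phi x))),
      eJ (phi (frac_one F n m)) (frac_one F n k) &
      (forall i x, okI x ->
         eJ (phi (frac_der der i x)) (frac_der der i (phi x)))]].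

(* Main.v *)
Require Import Defs.
From HB Require Import structures.
From mathcomp Require Import all_boot all_order all_algebra.
From mathcomp Require Import finmap monalg.
From mathcomp Require Import ring lra zify.
From mathcomp Require boolp classical_sets.

Set Implicit Arguments.
Unset Strict Implicit.
Unset Printing Implicit Defensive.

Import Order.TTheory GRing.Theory Num.Theory.
Local Open Scope ring_scope.

(** Let q be a common denominator of the images of the indeterminates of F{U}.
    As the birational map commutes with the derivations, an element of order at
    most l is sent to a fraction b / q^r with b of order at most l + l0, where l0
    does not depend on l.  Hence F{U}_{<=l} / I_{<=l} embeds into the localisation
    at q of F{V}_{<=l+l0} / J_{<=l+l0}, and the dimension cannot decrease, because
    the dimension of a finitely generated algebra over a field is the largest
    number of algebraically independent elements:
    - elements taken in the successive differences of a chain of primes are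
      algebraically independent;
    - conversely, from d algebraically independent elements a chain of d + 1
      primes is built by specialising one of them at a time to a generic natural
      number; integrality over a localised polynomial ring shows that the others
      stay independent.
    By symmetry the two dimension polynomials satisfy
    omega_I(l) <= omega_J(l + l0) and omega_J(l) <= omega_I(l + l1) for large l,
    hence they have the same degree and the same leading coefficient. *)

(** * Prime ideals and residue fields *)

Definition ideal_in (B : comNzRingType) (P : B -> Prop) : Prop :=
  [/\ P 0, (forall a b, P a -> P b -> P (a + b)) &
      (forall r a, P a -> P (r * a))].

Definition prime_in (B : comNzRingType) (P : B -> Prop) : Prop :=
  [/\ ideal_in P, ~ P 1 & forall a b, P (a * b) -> P a \/ P b].

Section ResidueField.

Variables (B : comNzRingType) (P : B -> Prop) (primeP : prime_in P).

Definition primeb (b : B) : bool := boolp.asbool (P b).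

Lemma primebP b : reflect (P b) (b \in primeb).
Proof. exact: boolp.asboolP. Qed.

Lemma primeb_ideal : idealr_closed primeb.
Proof.
case: primeP => -[P0 PD PM] P1 _; split; first exact/primebP.
  by apply/primebP.
by move=> a u v /primebP Pu /primebP Pv; apply/primebP/PD => //; apply: PM.
Qed.

Lemma primeb_prime : prime_idealr_closed primeb.
Proof.
case: primeP => _ _ PP u v /primebP /PP [] /primebP -> //.
by rewrite orbT.
Qed.

HB.instance Definition _ := isIdealr.Build B primeb primeb_ideal.
HB.instance Definition _ := isPrimeIdealrClosed.Build B primeb primeb_prime.

Definition residue := {ideal_quot [the prime_idealr B of primeb]}.
HB.instance Definition _ := GRing.ComNzRing.on residue.

(** Invertibility is decided classically, giving [residue] the unit-ring structure on which the
    integral domain, and then its field of fractions, is built. *)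
Definition residue_unit : pred residue :=
  fun x => boolp.asbool (exists y, y * x = 1).

Definition residue_inv (x : residue) : residue :=
  if boolp.pselect (exists y, y * x = 1) is left h then sval (boolp.cid h)
  else x.

Lemma residue_mulVr : {in residue_unit, left_inverse 1 residue_inv *%R}.
Proof.
move=> x /boolp.asboolP ux; rewrite /residue_inv.
by case: boolp.pselect => // h; case: boolp.cid.
Qed.

Lemma residue_unitP (x y : residue) : y * x = 1 -> residue_unit x.
Proof. by move=> yx; apply/boolp.asboolP; exists y. Qed.

Lemma residue_inv_out : {in [predC residue_unit], residue_inv =1 id}.
Proof.
move=> x /boolp.asboolP ux; rewrite /residue_inv.
by case: boolp.pselect.
Qed.

HB.instance Definition _ := GRing.ComNzRing_hasMulInverse.Build residue
  residue_mulVr residue_unitP residue_inv_out.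

Lemma residue_idomain (x y : residue) : x * y = 0 -> (x == 0) || (y == 0).
Proof. exact: Quotient.rquot_IdomainAxiom. Qed.

HB.instance Definition _ := GRing.ComUnitRing_isIntegral.Build residue
  residue_idomain.

(** The field is the fraction field of [B / P]. Together with [kernel_prime], this trades primes for
    morphisms to fields. *)
Lemma residue_field : exists (K : fieldType) (h : {rmorphism B -> K}),
  forall b, h b = 0 <-> P b.
Proof.
exists {fraction residue}, (@FracField.tofrac residue \o (\pi_residue)%qT) => b.
have -> : (P b) <-> (\pi_residue b == 0)%qT.
  split; last first.
    rewrite -(rmorph0 (\pi_residue)%qT) -Quotient.idealrBE subr0.
    by move/primebP.
  move=> Pb; rewrite -(rmorph0 (\pi_residue)%qT) -Quotient.idealrBE subr0.
  exact/primebP.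
by split=> [/eqP|/eqP e]; rewrite /= ?tofrac_eq0 // e rmorph0.
Qed.

End ResidueField.

(** An ideal that is maximal among those containing [J] and disjoint from the multiplicative set [M]
    is prime; Zorn's lemma supplies one. *)
Lemma exists_prime_avoiding (B : comNzRingType) (J M : B -> Prop) :
  ideal_in J -> M 1 -> (forall a b, M a -> M b -> M (a * b)) ->
  (forall b, J b -> ~ M b) ->
  exists P, [/\ prime_in P, (forall b, J b -> P b) & forall b, P b -> ~ M b].
Proof.
move=> idJ M1 MM JM.
pose good (A : classical_sets.set B) := [/\ ideal_in A, (forall b, J b -> A b) &
                              forall b, A b -> ~ M b].
(* The empty set is admitted so that the empty chain has its union as a bound. *)
pose T (A : classical_sets.set B) := (A = classical_sets.set0) \/ good A.
case: (@classical_sets.Zorn_bigcup B T).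
  move=> C CT tot.
  case: (boolp.pselect (exists2 A, C A & good A)) => [[A0 CA0 gA0]|no]; last first.
    left; apply: boolp.funext => b; apply: boolp.propext; split => //.
    case=> A CA Ab; case: (CT _ CA) => [A0|gA]; first by rewrite -A0.
    by case: no; exists A.
  have nz A b : C A -> A b -> good A.
    by move=> CA Ab; case: (CT _ CA) => // A0'; move: Ab; rewrite A0'.
  right; split.
  - split.
    + by exists A0 => //; case: gA0 => -[].
    + move=> a b [A CA Aa] [A' CA' Ab].
      have [[_ AD _] _ _] := nz _ _ CA Aa; have [[_ AD' _] _ _] := nz _ _ CA' Ab.
      case: (tot _ _ CA CA') => sub.
        by exists A' => //; apply: AD' => //; apply: sub.
      by exists A => //; apply: AD => //; apply: sub.
    + move=> r a [A CA Aa]; have [[_ _ AM] _ _] := nz _ _ CA Aa.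
      by exists A => //; apply: AM.
  - by move=> b Jb; exists A0 => //; case: gA0 => _ + _; apply.
  - by move=> b [A CA Ab]; have [_ _] := nz _ _ CA Ab; apply.
move=> P [TP maxP].
have gJ : good J by split.
have gP : good P.
  case: TP => // P0; case: (maxP J); last by right.
  rewrite P0; split=> //.
  by case: idJ => J0 _ _ /(_ _ J0).
case: (gP) => -[P0 PD PM] JP PnM.
(* By maximality, the ideal generated by [P] and [x] meets [M]. *)
have ext x : ~ P x -> exists a p, P p /\ M (p + a * x).
  move=> nPx; apply: boolp.contrapT => no.
  pose Q b := exists a p, P p /\ b = p + a * x.
  apply: (maxP Q).
    split; last first.
      move=> QP; apply/nPx/QP; exists 1, 0; split=> //; ring.
    by move=> b Pb; exists 0, b; split=> //; ring.
  right; split.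
  - split.
    + by exists 0, 0; split => //; ring.
    + move=> _ _ [a [p [Pp ->]]] [a' [p' [Pp' ->]]].
      exists (a + a'), (p + p'); split; [exact: PD | ring].
    + move=> r _ [a [p [Pp ->]]]; exists (r * a), (r * p).
      by split; [exact: PM | ring].
  - by move=> b /JP Pb; exists 0, b; split=> //; ring.
  - by move=> _ [a [p [Pp ->]]] Mb; apply: no; exists a, p.
exists P; split=> //; split=> //; first by move/PnM; apply.
move=> a b Pab; apply: boolp.contrapT => /boolp.not_orP[/ext[c [p [Pp Mp]]]].
move=> /ext[c' [p' [Pp' Mp']]]; apply: (PnM _ _ (MM _ _ Mp Mp')).
(* A product of two elements of [M] would lie in [P], because [p], [p'] and [a * b] do. *)
have -> : (p + c * a) * (p' + c' * b) =
  (p' + c' * b) * p + ((c * a) * p' + c * c' * (a * b)) by ring.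
by apply: (PD); [|apply: (PD)]; apply: (PM).
Qed.

(** * Iterated polynomial rings and transcendental elements *)

(** Iterating [{poly _}] lets inductions on the number of variables treat one polynomial variable at
    a time; the last index is the outermost variable. *)
Fixpoint ipoly (F : fieldType) (N : nat) : idomainType :=
  if N is N'.+1 then {poly (ipoly F N')} else F.

Fixpoint ipolyC (F : fieldType) (N : nat) : {rmorphism F -> ipoly F N} :=
  match N return {rmorphism F -> ipoly F N} with
  | 0 => idfun
  | N'.+1 => polyC \o ipolyC F N'
  end.

(** The value [0] for [j >= N] is a default. *)
Fixpoint ipolyX (F : fieldType) (N j : nat) : ipoly F N :=
  match N return ipoly F N with
  | 0 => 0
  | N'.+1 => if j == N' then 'X else (ipolyX F N' j)%:P
  end.

Definition adjoin (D K : comNzRingType) (i : {rmorphism D -> K}) (x : K) :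
  {rmorphism {poly D} -> K} := horner_morph (fun y => mulrC x (i y)).

Lemma adjoinE (D K : comNzRingType) (i : {rmorphism D -> K}) x p :
  adjoin i x p = (map_poly i p).[x].
Proof. by []. Qed.

Lemma adjoinC (D K : comNzRingType) (i : {rmorphism D -> K}) x c :
  adjoin i x c%:P = i c.
Proof. exact: horner_morphC. Qed.

Lemma adjoinX (D K : comNzRingType) (i : {rmorphism D -> K}) x :
  adjoin i x 'X = x.
Proof. exact: horner_morphX. Qed.

Fixpoint ieval (F : fieldType) (R : comNzRingType) (f : {rmorphism F -> R})
    (x : nat -> R) (N : nat) : {rmorphism ipoly F N -> R} :=
  match N return {rmorphism ipoly F N -> R} with
  | 0 => f
  | N'.+1 => adjoin (ieval f x N') (x N')
  end.

Lemma ieval_C F R f x N c : @ieval F R f x N (ipolyC F N c) = f c.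
Proof. by elim: N => //= N IH; rewrite adjoinC. Qed.

Lemma ieval_X F R f x N j : (j < N)%N -> @ieval F R f x N (ipolyX F N j) = x j.
Proof.
elim: N => //= N IH; rewrite ltnS leq_eqVlt.
have [->|/= _ /IH] := eqVneq j N; first by rewrite adjoinX.
by rewrite adjoinC.
Qed.

Lemma ipoly_ind F N (T : ipoly F N -> Prop) :
  (forall a b, T a -> T b -> T (a + b)) ->
  (forall a b, T a -> T b -> T (a * b)) ->
  (forall c, T (ipolyC F N c)) -> (forall j, (j < N)%N -> T (ipolyX F N j)) ->
  forall g, T g.
Proof.
elim: N T => [|N IH] T TD TM TC TX g; first exact: TC.
have TP c : T (c%:P).
  apply: (IH (fun c => T c%:P)) => //.
  - by move=> a b Ta Tb; rewrite polyCD; apply: TD.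
  - by move=> a b Ta Tb; rewrite polyCM; apply: TM.
  - move=> j lj; have := TX j (ltnW lj); rewrite /= ltn_eqF //.
have TX' : T ('X : {poly ipoly F N}) by have := TX N (ltnSn N); rewrite /= eqxx.
elim/poly_ind: g => [|p c Tp]; first exact: (TP 0).
by apply: TD => //; apply: TM.
Qed.

Section Transcendence.

Variable K : fieldType.

(* [i] need not be injective: transcendence is over the subring [i D] of [K]. *)
Definition transc (D : comNzRingType) (i : {rmorphism D -> K}) (x : K) :=
  forall p : {poly D}, adjoin i x p = 0 -> map_poly i p = 0.

Definition algebraic_over (R : comNzRingType) (r : {rmorphism R -> K}) (y : K) :=
  exists2 q : {poly R}, map_poly r q != 0 & root (map_poly r q) y.

Lemma adjoin_swap (D : comNzRingType) (i : {rmorphism D -> K}) x y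
    (p : {poly {poly D}}) :
  adjoin (adjoin i x) y (swapXY p) = adjoin (adjoin i y) x p.
Proof.
have key z (u : {poly {poly D}}) : map_poly (adjoin i z) u =
    map_poly (horner_eval z) (map_poly (map_poly i) u).
  by rewrite -map_poly_comp.
have ev z t (u : {poly {poly D}}) : adjoin (adjoin i z) t u =
    (map_poly (map_poly i) u).[t, z].
  rewrite [LHS]adjoinE key.
  rewrite -{1}[t](hornerC t z) -/(horner_eval z _) horner_map.
  by rewrite /horner_eval.
by rewrite !ev -swapXY_map horner2_swapXY.
Qed.

(** A form of the exchange property: a nontrivial relation for [x] over [D[y]], with its two
    variables swapped, is a relation for [y] over [D[x]], and it stays nontrivial because [x] is
    transcendental over [D]. *)
Lemma transc_or_algebraic (D : comNzRingType) (i : {rmorphism D -> K}) x y :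
  transc i x -> transc (adjoin i y) x \/ algebraic_over (adjoin i x) y.
Proof.
move=> tx; case: (boolp.pselect (transc (adjoin i y) x)) => [|ntr]; [by left|right].
move/boolp.existsNP: ntr => [p /boolp.not_implyP[px0 /eqP pn0]].
exists (swapXY p); last by apply/eqP; rewrite -[RHS]px0 -adjoin_swap.
apply: contra_neq pn0 => /polyP q0.
suff P0 : map_poly (map_poly i) p = 0.
  apply/polyP=> j; rewrite coef_map coef0 [LHS](adjoinE i y).
  by move/polyP: P0 => /(_ j); rewrite coef_map coef0 => ->; rewrite horner0.
apply/eqP; rewrite -swapXY_eq0 swapXY_map; apply/eqP/polyP => j.
rewrite coef_map coef0; apply: tx.
by have := q0 j; rewrite coef_map coef0.
Qed.

(** The elements of [ys] are taken in turn: each is adjoined to [D] if [x] remains transcendental,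
    and is otherwise already algebraic over [D[x]], a property that persists when [D] grows. *)
Lemma saturate_transc x (ys : seq K) (D : comNzRingType) (i : {rmorphism D -> K}) :
  transc i x ->
  exists (D' : comNzRingType) (i' : {rmorphism D' -> K}) (j : {rmorphism D -> D'}),
    [/\ forall d, i' (j d) = i d, transc i' x &
        forall y, y \in ys -> algebraic_over (adjoin i' x) y].
Proof.
elim: ys D i => [|y ys IH] D i tx; first by exists D, i, idfun.
case: (transc_or_algebraic y tx) => [ty|[q qn0 qy]].
  have [D' [i' [j [ji tx' alg]]]] := IH _ _ ty.
  exists D', i', (j \o polyC); split=> // [d|z]; first by rewrite /= ji adjoinC.
  rewrite inE => /predU1P[->|/alg //].
  (* The adjoined [y] is the image of [j 'X], so it is a root of a linear polynomial. *)
  exists ('X - (j 'X)%:P%:P).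
    by rewrite rmorphB /= map_polyX map_polyC /= monic_neq0 // monicXsubC.
  rewrite rmorphB /= map_polyX map_polyC /= root_XsubC.
  by rewrite (adjoinC i' x) ji adjoinX.
have [D' [i' [j [ji tx' alg]]]] := IH _ _ tx.
exists D', i', j; split=> // z; rewrite inE => /predU1P[->|/alg //].
have E : map_poly (adjoin i' x) (map_poly (map_poly j) q) =
         map_poly (adjoin i x) q.
  rewrite -map_poly_comp; apply: eq_map_poly => c /=.
  by rewrite !adjoinE -map_poly_comp; congr _.[_]; apply: eq_map_poly.
by exists (map_poly (map_poly j) q); rewrite E.
Qed.

(** With [a] the leading coefficient of a relation of degree [t + 1] for [y], multiplying the
    relation by [a^t] makes it monic in [a * y]. *)
Lemma algebraic_scaled_integral (R : comNzRingType) (r : {rmorphism R -> K}) y :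
  algebraic_over r y -> exists2 a, r a != 0 & integralOver r (r a * y).
Proof.
case=> q; set Q := map_poly r q => Qn0 Qy.
have [t sQ] : exists t, size Q = t.+2.
  have := root_size_gt1 Qn0 Qy; case: (size Q) => [|[|t]] // _; by exists t.
have Qj j : r q`_j = Q`_j by rewrite coef_map.
exists q`_t.+1; first by rewrite Qj -[t.+1]/(t.+2.-1) -sQ -lead_coefE lead_coef_eq0.
set a := q`_t.+1.
pose p : {poly R} := 'X^(t.+1) + \poly_(j < t.+1) (q`_j * a ^+ (t - j)).
have szl : (size (\poly_(j < t.+1) (q`_j * a ^+ (t - j)))%R <
            size ('X^(t.+1) : {poly R})%R)%N.
  by rewrite size_polyXn ltnS size_poly.
exists p.
  by rewrite monicE lead_coefDl // lead_coefXn.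
apply/rootP; rewrite rmorphD /= map_polyXn hornerD hornerXn.
have -> : map_poly r (\poly_(j < t.+1) (q`_j * a ^+ (t - j))) =
          \poly_(j < t.+1) (Q`_j * r a ^+ (t - j)).
  apply/polyP=> j; rewrite coef_map 2!coef_poly; case: ifP => _; last exact: rmorph0.
  by rewrite [LHS](rmorphM r) rmorphXn (Qj j).
rewrite horner_poly.
move/rootP: Qy; rewrite horner_coef sQ big_ord_recr /= => Qy.
have -> : \sum_(j < t.+1) Q`_j * r a ^+ (t - j) * (r a * y) ^+ j =
          r a ^+ t * \sum_(j < t.+1) Q`_j * y ^+ j.
  rewrite mulr_sumr; apply: eq_bigr => j _.
  have le_jt : (j <= t)%N by rewrite -ltnS.
  have -> : r a ^+ t = r a ^+ (t - j) * r a ^+ j by rewrite -exprD subnK.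
  by rewrite exprMn; ring.
rewrite exprMn exprS -[r a]/(r q`_t.+1) Qj.
transitivity (Q`_t.+1 ^+ t * (\sum_(i < t.+1) Q`_i * y ^+ i + Q`_t.+1 * y ^+ t.+1)).
  by ring.
by rewrite Qy mulr0.
Qed.

Lemma common_denominator (R : comNzRingType) (r : {rmorphism R -> K}) (ys : seq K) :
  (forall y, y \in ys -> algebraic_over r y) ->
  exists2 a, r a != 0 & forall y, y \in ys -> integralOver r (r a * y).
Proof.
elim: ys => [|y ys IH] alg; first by exists 1; rewrite ?rmorph1 ?oner_eq0.
have [|b bn0 ib] := IH; first by move=> z zy; apply: alg; rewrite inE zy orbT.
have [|a an0 ia] := @algebraic_scaled_integral _ r y; first by apply: alg; rewrite inE eqxx.
exists (a * b); first by rewrite rmorphM mulf_neq0.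
move=> z; rewrite inE rmorphM => /predU1P[->|/ib iz].
  by rewrite mulrAC; apply: integral_mul => //; apply: integral_id.
by rewrite -mulrA; apply: integral_mul => //; apply: integral_id.
Qed.

(* If [x - c] divides [i d] in the image of [h], the quotient becomes integral
   over [D'[x]] after multiplication by a power of a fixed denominator [a];
   clearing denominators in an integral equation and putting [x := c] shows
   that [a.[c]] or [d] vanishes. *)
Lemma generic_specialization (F : fieldType) (N : nat)
    (h : {rmorphism ipoly F N -> K}) (D : comNzRingType) (i : {rmorphism D -> K}) x :
  [pchar K] =i pred0 -> transc i x ->
  (forall c, exists d, i d = h (ipolyC F N c)) ->
  exists c : nat, x != c%:R /\ forall g d, (x - c%:R) * h g = i d -> i d = 0.
Proof.
move=> chK tx Fi.
have [D' [i' [j [ji tx' alg]]]] :=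
  saturate_transc [seq h (ipolyX F N k) | k <- iota 0 N] tx.
have [a an0 ia] := common_denominator alg.
pose r := adjoin i' x.
(* The property is stable under sums and products, so constants and variables suffice. *)
have ig g : exists M, integralOver r (r a ^+ M * h g).
  have idX M z : integralOver r z -> integralOver r (r a ^+ M * z).
    by move=> iz; rewrite -rmorphXn; apply: integral_mul => //; apply: integral_id.
  apply: (@ipoly_ind F N (fun g => exists M, integralOver r (r a ^+ M * h g))).
  - move=> b c [M iM] [M' iM']; exists (M + M')%N.
    rewrite rmorphD mulrDr exprD; apply: integral_add.
      by rewrite mulrAC mulrC; apply: idX.
    by rewrite -mulrA; apply: idX.
  - move=> b c [M iM] [M' iM']; exists (M + M')%N.
    by rewrite rmorphM exprD mulrACA; apply: integral_mul.
  - move=> c; exists 0%N; rewrite mul1r; have [d <-] := Fi c.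
    by rewrite -ji -(adjoinC i' x); apply: integral_id.
  - move=> k lk; exists 1%N; rewrite expr1; apply: ia.
    by apply: map_f; rewrite mem_iota.
have an0' : map_poly i' a != 0.
  by apply: contraNneq an0 => a0; rewrite adjoinE a0 horner0.
(* In characteristic zero the natural numbers are pairwise distinct in [K], too many to be all roots
   of a nonzero polynomial. *)
have [c cn0] : exists c : nat, (map_poly i' a).[c%:R] != 0.
  apply: boolp.contrapT => no.
  pose rs := [seq (c%:R : K) | c <- iota 0 (size (map_poly i' a))].
  have : (size rs < size (map_poly i' a))%N.
    apply: max_poly_roots => //.
      apply/allP=> z /mapP[c _ ->]; apply/rootP/eqP/negPn/negP => cn.
      by apply: no; exists c.
    rewrite map_inj_uniq ?iota_uniq // => u v; wlog le: u v / (u <= v)%N.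
      by move=> W /[dup] e; case: (leqP u v) => [/W|/ltnW/W] H // /esym/H.
    move=> /eqP; rewrite eq_sym -subr_eq0 -natrB // => /eqP e.
    apply/eqP; rewrite eqn_leq le /= -subn_eq0; apply/eqP.
    by move/pcharf0P: chK => /(_ (v - u)%N); rewrite e eqxx => /esym/eqP.
  by rewrite size_map size_iota ltnn.
exists c; split.
  apply/negP => /eqP xc.
  have /tx' : adjoin i' x ('X - c%:R%:P) = 0.
    by rewrite rmorphB /= adjoinX adjoinC rmorph_nat xc subrr.
  rewrite rmorphB /= map_polyX map_polyC /= => /eqP.
  by apply/negP; rewrite monic_neq0 // monicXsubC.
move=> g d E.
have [M [p mon_p /rootP pz]] := ig g.
set z := r a ^+ M * h g in pz.
have zE : r a ^+ M * i d = (x - c%:R) * z by rewrite -E mulrCA.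
have [t szp] : exists t, size p = t.+1.
  by exists (size p).-1; rewrite prednK // lt0n size_poly_eq0 monic_neq0.
(* By [zE], the value of [G] at [x] is [(x - c)^t] times the integral equation of [z], hence zero;
   transcendence of [x] then kills the image of [G] under [i']. *)
pose G : {poly D'} :=
  \sum_(k < t.+1) p`_k * ('X - c%:R%:P) ^+ (t - k) * (a ^+ M * (j d)%:P) ^+ k.
have /tx' G0 : adjoin i' x G = 0.
  rewrite rmorph_sum /=.
  transitivity ((x - c%:R) ^+ t * (map_poly r p).[z]); last by rewrite pz mulr0.
  rewrite (horner_coef_wide _ (_ : size (map_poly r p) <= t.+1)%N); last first.
    by rewrite -szp; apply: size_poly.
  rewrite mulr_sumr; apply: eq_bigr => k _.
  have le_kt : (k <= t)%N by rewrite -ltnS.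
  rewrite !rmorphM !rmorphXn rmorphB rmorphM rmorphXn /= adjoinX !adjoinC ji.
  have -> : (x - c%:R) ^+ t = (x - c%:R) ^+ (t - k) * (x - c%:R) ^+ k.
    by rewrite -exprD subnK.
  rewrite rmorph_nat zE exprMn coef_map.
  by rewrite -[adjoin i' x p`_k]/(r p`_k); ring.
have : adjoin i' c%:R G = 0 by rewrite adjoinE G0 horner0.
(* At [c] only the term [k = t] survives, and its coefficient is [1] since [p] is monic. *)
rewrite rmorph_sum /= big_ord_recr /= big1 ?add0r; last first.
  move=> k _; rewrite !rmorphM !rmorphXn rmorphB /= adjoinX adjoinC rmorph_nat.
  by rewrite subrr expr0n subn_eq0 leqNgt ltn_ord /= mulr0 mul0r.
rewrite subnn expr0 mulr1.
have -> : p`_t = 1 by move/monicP: mon_p; rewrite lead_coefE szp.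
rewrite mul1r !rmorphXn rmorphM rmorphXn /= adjoinC ji adjoinE => /eqP.
rewrite expf_eq0 => /andP[_]; rewrite mulf_eq0 expf_eq0 (negPf cn0) andbF /=.
by move/eqP.
Qed.

End Transcendence.

(** * Chains of primes and algebraic independence *)

Arguments adjoin : simpl never.

Definition strict_chain (T : Type) (c : nat -> T -> Prop) (d : nat) : Prop :=
  forall k, (k < d)%N ->
    (forall p, c k p -> c k.+1 p) /\ exists p, c k.+1 p /\ ~ c k p.

Lemma adjoin_comp (D R K : comNzRingType) (e : {rmorphism D -> R})
    (h : {rmorphism R -> K}) x p :
  adjoin (h \o e) (h x) p = h (adjoin e x p).
Proof. by rewrite !adjoinE map_poly_comp horner_map. Qed.

Lemma ieval_ext F R f x y N : (forall j, (j < N)%N -> x j = y j) ->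
  @ieval F R f x N =1 ieval f y N.
Proof.
elim: N => //= N IH xy g; rewrite !adjoinE xy //; congr _.[_].
by apply: eq_map_poly; apply: IH => j lj; apply: xy; rewrite ltnW.
Qed.

Lemma ieval_closed (F : fieldType) (R : comNzRingType) (f : {rmorphism F -> R})
    (S : R -> Prop) x N :
  (forall a b, S a -> S b -> S (a + b)) -> (forall a b, S a -> S b -> S (a * b)) ->
  (forall c, S (f c)) -> (forall j, (j < N)%N -> S (x j)) ->
  forall g, S (ieval f x N g).
Proof.
move=> SD SM Sf Sx; apply: ipoly_ind => [a b Sa Sb|a b Sa Sb|c|j lj].
- by rewrite rmorphD; apply: SD.
- by rewrite rmorphM; apply: SM.
- by rewrite ieval_C.
- by rewrite ieval_X //; apply: Sx.
Qed.

(** The counterpart of [is_subprime] over an arbitrary ring; membership of [0] is stated apart where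
    it is required. *)
Definition prime_within (B : comNzRingType) (S P : B -> Prop) : Prop :=
  [/\ (forall p, P p -> S p), (forall p q, P p -> P q -> P (p + q)),
      (forall r p, S r -> P p -> P (r * p)), ~ P 1 &
      forall a b, S a -> S b -> P (a * b) -> P a \/ P b].

Section ChainIndep.

Variables (F : fieldType) (R : comNzRingType).
Variables (f : {rmorphism F -> R}) (S : R -> Prop).
Hypothesis SD : forall a b, S a -> S b -> S (a + b).
Hypothesis SM : forall a b, S a -> S b -> S (a * b).
Hypothesis Sf : forall c, S (f c).

(* Choosing [x j] in the successive differences of the chain, a polynomial
   relation is peeled off variable by variable: divide by the largest power of
   the outermost variable, then reduce modulo the next prime. *)
Lemma chain_alg_independent d (c : nat -> R -> Prop) :
  (forall k, (k <= d)%N -> prime_within S (c k)) -> strict_chain c d ->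
  exists x : nat -> R, (forall j, (j < d)%N -> S (x j)) /\
    forall g : ipoly F d, g != 0 -> ~ c 0%N (ieval f x d g).
Proof.
elim: d c => [|d IH] c pr sc.
  exists (fun=> 0); split=> // g gn0 c0g.
  have [_ _ cM c1 _] := pr 0%N isT; apply: c1.
  (* A nonzero constant is a unit, so it cannot lie in [c 0]. *)
  have <- : f g^-1 * f g = 1 by rewrite -rmorphM mulVf // rmorph1.
  exact: cM.
(* The tail of the chain gives [x], independent modulo [c 1]; an element [p] of [c 1] outside [c 0]
   is added as the outermost variable. *)
have [|k lk|x [Sx indep]] := IH (fun k => c k.+1); first by move=> k; apply: (pr k.+1).
  exact: (sc k.+1).
have [sub01 [p [c1p c0p]]] := sc 0%N isT.
exists (fun j => if j == d then p else x j).
have [subS1 c1D c1M _ _] := pr 1%N isT.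
have [_ _ _ _ c0P] := pr 0%N isT.
have Sp : S p by apply: subS1.
set x' := fun j => _.
have Sx' j : (j < d.+1)%N -> S (x' j).
  rewrite /x' ltnS leq_eqVlt; case: eqVneq => //= _; exact: Sx.
have Sev g : S (ieval f x' d g).
  by apply: ieval_closed => // j lj; apply: Sx'; rewrite ltnW.
have x'd : x' d = p by rewrite /x' eqxx.
split=> //; rewrite [ieval _ _ _]/= x'd.
have e' g : ieval f x' d g = ieval f x d g.
  by apply: ieval_ext => j lj; rewrite /x' ltn_eqF.
have Sadj g : S (adjoin (ieval f x' d) p g).
  have := @ieval_closed F R f S x' d.+1 SD SM Sf Sx' g.
  by rewrite [ieval _ _ _]/= x'd.
elim/poly_ind => [|h a IHh]; first by rewrite eqxx.
rewrite rmorphD rmorphM /= adjoinX adjoinC.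
have [->|an0 _ c0g] := eqVneq a 0.
  rewrite polyC0 addr0 (rmorph0 (ieval f x' d)) addr0 => hn0.
  move=> /(c0P _ _ (Sadj h) Sp) [] //.
  by apply: IHh; apply: contraNneq hn0 => ->; rewrite mul0r.
apply: (indep a an0); rewrite -e'.
(* The relation lies in [c 0], hence in [c 1], and so does [p]; the constant term [a] therefore
   gives a relation modulo [c 1]. *)
have -> : ieval f x' d a = (adjoin (ieval f x' d) p h * p + ieval f x' d a) +
    (f (-1) * adjoin (ieval f x' d) p h) * p by rewrite rmorphN rmorph1; ring.
apply: c1D; first exact: sub01.
by apply: c1M => //; apply: SM.
Qed.

End ChainIndep.

Lemma kernel_prime (B : comNzRingType) (K : fieldType) (h : {rmorphism B -> K}) :
  prime_in (fun b => h b = 0).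
Proof.
split.
- split; first exact: rmorph0.
  + by move=> a b ha hb; rewrite rmorphD ha hb addr0.
  + by move=> r a ha; rewrite rmorphM ha mulr0.
- by rewrite rmorph1; apply/eqP; apply: oner_neq0.
- by move=> a b /eqP; rewrite rmorphM mulf_eq0 => /orP[] /eqP; [left|right].
Qed.

(** Induction on [d]: a generic specialisation [xi d := c0] leads to a prime [Q] strictly above the
    kernel of [h], modulo which the first [d] elements stay independent. The chain found above [Q]
    is then prefixed with that kernel. *)
Lemma prime_chain_above_kernel (F : fieldType) (N d : nat) (K : fieldType)
    (h : {rmorphism ipoly F N -> K}) (xi : nat -> ipoly F N) :
  [pchar F] =i pred0 ->
  (forall g, g != 0 -> h (ieval (ipolyC F N) xi d g) != 0) ->
  exists c : nat -> ipoly F N -> Prop,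
    (forall k, (k <= d)%N -> prime_in (c k) /\ forall b, h b = 0 -> c k b) /\
    strict_chain c d.
Proof.
move=> chF; elim: d K h => [|d IH] K h hinj.
  exists (fun=> fun b => h b = 0); split=> // k _; split=> //.
  exact: kernel_prime.
pose e := ieval (ipolyC F N) xi d.
pose i : {rmorphism ipoly F d -> K} := h \o e.
have iinj f : f != 0 -> i f != 0.
  move=> fn0; have := hinj f%:P; rewrite /= adjoinC; apply.
  by rewrite polyC_eq0.
have tx : transc i (h (xi d)).
  move=> p; rewrite adjoin_comp => /eqP hp0.
  have [->|/hinj] := eqVneq p 0; first by rewrite rmorph0.
  by rewrite /= hp0.
have chK : [pchar K] =i pred0.
  by move=> p; rewrite -(chF p) (fmorph_pchar (h \o ipolyC F N)).
have [|c0 [xc0 spec]] := generic_specialization (h := h) chK tx.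
  by move=> c; exists (ipolyC F d c); rewrite /i /= /e ieval_C.
pose b := xi d - c0%:R.
have hb : h b = h (xi d) - c0%:R by rewrite rmorphB rmorph_nat.
(* [Q] contains [b] and the kernel of [h], and avoids everything with the same image as a nonzero
   polynomial in the first [d] elements; [spec] shows that these requirements are compatible. *)
have [||||Q [prQ JQ MQ]] := @exists_prime_avoiding (ipoly F N)
    (fun g => exists g', h g = h b * h g')
    (fun g => exists2 f, f != 0 & h g = i f).
- split.
  + by exists 0; rewrite !rmorph0 mulr0.
  + move=> u v [u' Eu] [v' Ev]; exists (u' + v').
    by rewrite [LHS]rmorphD Eu Ev [h (u' + v')]rmorphD mulrDr.
  + move=> r u [u' Eu]; exists (r * u').
    by rewrite [LHS]rmorphM Eu [h (r * u')]rmorphM mulrCA.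
- by exists 1; rewrite ?oner_neq0 ?rmorph1.
- move=> u v [u' un0 Eu] [v' vn0 Ev]; exists (u' * v'); first by rewrite mulf_neq0.
  by rewrite !rmorphM Eu Ev.
- move=> g [g' Eg] [f fn0 Ef]; move: (iinj _ fn0).
  by rewrite (spec g' f) ?eqxx // -Ef Eg hb.
have [K' [h' kerh']] := residue_field prQ.
have [f fn0|c [prc sc]] := IH K' h'.
  apply/negP => /eqP /kerh' /MQ; apply; by exists f.
have kQ g : h g = 0 -> Q g by move=> hg; apply: JQ; exists 0; rewrite hg rmorph0 mulr0.
exists (fun k => if k is k'.+1 then c k' else fun g => h g = 0); split.
  case=> [_|k lk]; first by split=> //; apply: kernel_prime.
  have [pk hk] := prc k lk; split=> // g /kQ Qg; apply: hk; exact/kerh'.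
case=> [_|k lk]; last exact: sc.
have [_ h0] := prc 0%N isT; split=> [g /kQ Qg|]; first by apply: h0; apply/kerh'.
exists b; split; last by rewrite hb; apply/eqP; rewrite subr_eq0.
by apply/h0/kerh'/JQ; exists 1; rewrite rmorph1 mulr1.
Qed.

(** * Differential polynomials *)

Section MonoidAlgebra.

Variables (K : conomType) (A : comNzRingType).

Lemma monalgUM (c c' : A) (k k' : K) :
  << c *g k >> * << c' *g k' >> = << c * c' *g mmul k k' >> :> {malg A[K]}.
Proof. by rewrite malgM_def fgmulUU. Qed.

Lemma monalgU_scale (c : A) (k : K) : << c *g k >> = c *: << k >> :> {malg A[K]}.
Proof. by apply/malgP=> k'; rewrite mcoeffZ !mcoeffU mulrnAr mulr1. Qed.

Lemma monalgU1M (k k' : K) : << k >> * << k' >> = << mmul k k' >> :> {malg A[K]}.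
Proof. by rewrite monalgUM mulr1. Qed.

Lemma monalgUC (c : A) (k : K) : << c *g k >> = c%:MP * << k >> :> {malg A[K]}.
Proof. by rewrite mul_malgC monalgU_scale. Qed.

Lemma malgC_scale1 (c : A) : c%:MP = c *: 1 :> {malg A[K]}.
Proof. by rewrite -mul_malgC mulr1. Qed.

End MonoidAlgebra.

(** The contribution of one variable to the Leibniz rule for a product of two monomials, with
    exponents [a] and [b]. *)
Lemma natr_leibniz (A : comNzRingType) (a b : nat) (w u v u' v' x : A) :
  a%:R * w = a%:R * u * v' -> b%:R * w = b%:R * v * u' ->
  (a + b)%:R * w * x = a%:R * u * x * v' + u' * (b%:R * v * x).
Proof. by move=> Ea Eb; rewrite natrD !mulrDl Ea Eb; ring. Qed.

(** Leibniz for coefficients and for monomials implies Leibniz for terms; every product has a name,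
    so that what remains is a ring identity. *)
Lemma scaled_leibniz (A0 A : comNzRingType) (C : {rmorphism A0 -> A}) (D : A -> A)
    (a b da db dab : A0) (x y xy dx dy dxy p q pq : A) :
  p * q = pq -> p = C a * x -> q = C b * y -> xy = x * y ->
  D p = C da * x + C a * dx -> D q = C db * y + C b * dy ->
  D pq = C dab * xy + C (a * b) * dxy ->
  dab = da * b + a * db -> dxy = dx * y + x * dy ->
  D (p * q) = D p * q + p * D q.
Proof.
move=> -> Ep Eq -> -> -> -> -> ->; rewrite Ep Eq rmorphD !rmorphM; ring.
Qed.

Lemma leibniz_sum (A : comNzRingType) (D : A -> A) (I : Type) (r : seq I)
    (f : I -> A) (b : A) :
  (forall x y, D (x + y) = D x + D y) -> D 0 = 0 ->
  (forall k, D (f k * b) = D (f k) * b + f k * D b) ->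
  D ((\sum_(k <- r) f k) * b) =
  D (\sum_(k <- r) f k) * b + (\sum_(k <- r) f k) * D b.
Proof.
move=> DD D0 Df; rewrite mulr_suml !(big_morph D DD D0) !mulr_suml -big_split.
exact: eq_bigr.
Qed.

Lemma leibniz_swap (A : comNzRingType) (D : A -> A) (a b : A) :
  D (b * a) = D b * a + b * D a -> D (a * b) = D a * b + a * D b.
Proof. by rewrite mulrC => ->; ring. Qed.

(** * Derivations and orders of differential polynomials *)

Section Derivation.

Variables (F : fieldType) (n : nat) (der : 'I_n -> F -> F) (m : nat).
Hypothesis derP : is_diff_field der.
Local Notation R := (DP F n m).
Local Notation mon := {cmonom (dvar n m)}.

Lemma der0 i : der i 0 = 0.
Proof.
case: derP => _ dD _ _; have := dD i 0 0; rewrite addr0 => /eqP.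
by rewrite -subr_eq0 opprD addNKr oppr_eq0 => /eqP.
Qed.

Lemma der1 i : der i 1 = 0.
Proof.
case: derP => _ _ dM _; have := dM i 1 1; rewrite !mulr1 mul1r => /eqP.
by rewrite -subr_eq0 opprD addNKr oppr_eq0 => /eqP.
Qed.

Lemma dmonEw i (k : mon) (d : {fset dvar n m}) : (finsupp k `<=` d)%fset ->
  dmon F i k = \sum_(x <- d) ((k x)%:R * << divcm k (ucm x) >> * Xv F (shiftv i x)).
Proof.
move=> sd; apply: big_fset_incl => // x _; rewrite -cmE_eq0 => /eqP ->.
by rewrite mulr0n [0 * << _ >>]mul0r mul0r.
Qed.

Lemma dmonM i (k k' : mon) :
  dmon F i (mmul k k') = dmon F i k * << k' >> + << k >> * dmon F i k'.
Proof.
(* The quotient [divcm] is truncated, so it is compatible with products only when [x] occurs in [u];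
   the factor [u x] covers the other case. *)
have div (u v : mon) x : (u x)%:R * << divcm (mmul u v) (ucm x) >> =
    (u x)%:R * << divcm u (ucm x) >> * << v >> :> R.
  have [ux0|un0] := eqVneq (u x) 0%N.
    by rewrite ux0 mulr0n [LHS]mul0r [0 * _]mul0r mul0r.
  rewrite -mulrA monalgU1M; congr (_ * << _ >>); apply/eqP/cmP => y.
  rewrite cmM !divcmE cmM cmU; have [<-|] := eqVneq x y; last by rewrite !subn0.
  by rewrite addnBAC // lt0n.
rewrite (@dmonEw i _ (finsupp k `|` finsupp k')%fset); last by rewrite mdomD.
rewrite (@dmonEw i k (finsupp k `|` finsupp k')%fset) ?fsubsetUl //.
rewrite (@dmonEw i k' (finsupp k `|` finsupp k')%fset) ?fsubsetUr //.
rewrite mulr_suml mulr_sumr -big_split /=; apply: eq_bigr => x _.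
rewrite cmM; apply: natr_leibniz; first exact: div.
have -> : mmul k k' = mmul k' k by apply: mulcmC.
exact: div.
Qed.

Definition dterm i (c : F) (k : mon) : R := << der i c *g k >> + c *: dmon F i k.

Lemma dtermE i c k : dterm i c k = (der i c)%:MP * << k >> + c%:MP * dmon F i k.
Proof. by rewrite /dterm monalgUC -mul_malgC. Qed.

Lemma dterm0 i k : dterm i 0 k = 0.
Proof. by rewrite /dterm der0 monalgU0 scale0r addr0. Qed.

Lemma dtermD i c c' k : dterm i (c + c') k = dterm i c k + dterm i c' k.
Proof.
case: derP => _ dD _ _; rewrite /dterm dD monalgUD scalerDl; exact: addrACA.
Qed.

Lemma dderEw i (p : R) (d : {fset mon}) : (msupp p `<=` d)%fset ->
  dder der i p = \sum_(k <- d) dterm i p@_k k.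
Proof.
move=> sd; apply: big_fset_incl => // k _ /mcoeff_outdom ->.
exact: dterm0.
Qed.

Lemma dderU i c k : dder der i << c *g k >> = dterm i c k.
Proof. by rewrite (dderEw _ msuppU_le) big_seq_fset1 mcoeffUU. Qed.

Lemma dderD i (p q : R) : dder der i (p + q) = dder der i p + dder der i q.
Proof.
rewrite (dderEw _ (msuppD_le p q)) (dderEw _ (fsubsetUl (msupp p) (msupp q))).
rewrite (dderEw _ (fsubsetUr (msupp p) (msupp q))) -big_split /=.
by apply: eq_bigr => k _; rewrite mcoeffD dtermD.
Qed.

Lemma dder0 i : dder der i 0 = 0 :> R.
Proof. by rewrite /dder msupp0 big_seq_fset0. Qed.

Lemma dderUM i (c : F) (k : mon) (c' : F) (k' : mon) :
  let p := << c *g k >> in let q := << c' *g k' >> in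
  dder der i (p * q) = dder der i p * q + p * dder der i q :> R.
Proof.
case: derP => _ _ dM _.
have dU c0 k0 := etrans (dderU i c0 k0) (dtermE i c0 k0).
exact: (scaled_leibniz (monalgUM c c' k k') (monalgUC c k) (monalgUC c' k')
  (esym (monalgU1M F k k')) (dU c k) (dU c' k') (dU (c * c') (mmul k k'))
  (dM i c c') (dmonM i k k')).
Qed.

Lemma dderM i (p q : R) :
  dder der i (p * q) = dder der i p * q + p * dder der i q.
Proof.
rewrite (monalgE p); apply: leibniz_sum => [||k]; [exact: dderD|exact: dder0|].
apply: leibniz_swap; rewrite (monalgE q).
apply: leibniz_sum => [||k']; [exact: dderD|exact: dder0|exact: dderUM].
Qed.

Lemma dder1 i : dder der i 1 = 0 :> R.
Proof.
have := dderM i 1 1; rewrite !mulr1 mul1r => /eqP.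
by rewrite -subr_eq0 opprD addNKr oppr_eq0 => /eqP.
Qed.

Lemma dderN i (p : R) : dder der i (- p) = - dder der i p.
Proof. by apply/eqP; rewrite -addr_eq0 -dderD addNr dder0. Qed.

Lemma dderB i (p q : R) : dder der i (p - q) = dder der i p - dder der i q.
Proof. by rewrite dderD dderN. Qed.

Lemma dder_Xv i (x : dvar n m) : dder der i (Xv F x) = Xv F (shiftv i x).
Proof.
rewrite /Xv dderU /dterm der1 monalgU0 add0r scale1r /dmon mdomU big_seq_fset1.
rewrite cmUU mulr1n [1 * _]mul1r monalgU1M; congr << _ >>; apply/eqP/cmP => y.
by rewrite cmM divcmE subnn.
Qed.

Lemma dideal_genP (A : R -> Prop) : is_dideal der (dideal_gen der A).
Proof.
split; first split.
- by move=> J [[J0 _ _] _].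
- by move=> p q Ip Iq J dJ AJ; case: (dJ) => -[_ JD _] _; apply: JD; [apply: Ip|apply: Iq].
- by move=> r p Ip J dJ AJ; case: (dJ) => -[_ _ JM] _; apply: JM; apply: Ip.
- by move=> i p Ip J dJ AJ; case: (dJ) => _ Jd; apply: Jd; apply: Ip.
Qed.

Lemma mclosM (H : R -> Prop) a b : mclos H a -> mclos H b -> mclos H (a * b).
Proof.
move=> [la [Hla ->]] [lb [Hlb ->]]; exists (la ++ lb); rewrite big_cat; split=> //.
by move=> x; rewrite mem_cat => /orP[/Hla|/Hlb].
Qed.

(** Stability under a derivation [D] comes from [a^2 D(p) = a D(a p) - D(a) (a p)]. *)
Lemma saturation_dideal (J H : R -> Prop) :
  is_dideal der J -> is_dideal der (saturation J H).
Proof.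
move=> [[J0 JD JM] Jd]; split; first split.
- exists 1; rewrite mulr0; split=> //; exists [::]; split=> //; by rewrite big_nil.
- move=> p q [a [ma Ja]] [b [mb Jb]]; exists (a * b); split; first exact: mclosM.
  have -> : a * b * (p + q) = b * (a * p) + a * (b * q) by ring.
  by apply: JD; apply: JM.
- move=> r p [a [ma Ja]]; exists a; split; first exact: ma.
  have -> : a * (r * p) = r * (a * p) by ring.
  exact: JM.
- move=> i p [a [ma Ja]]; exists (a * a); split; first exact: mclosM.
  have -> : a * a * dder der i p = a * dder der i (a * p) +
      (- dder der i a) * (a * p).
    by rewrite (dderM i a p) mulrDr; move: (dder _ _ a) (dder _ _ p) => u v; ring.
  by apply: JD; apply: JM; [apply: Jd; exact: Ja|exact: Ja].
Qed.

Lemma characterizable_dideal (J : R -> Prop) :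
  characterizable der J -> is_dideal der J.
Proof.
case=> rk [S [_ _ JE]].
have [[J0 JD JM] Jd] : is_dideal der (IS der rk (fun s => s \in S)).
  exact/saturation_dideal/dideal_genP.
split; [split|].
- exact/JE.
- by move=> p q /JE Jp /JE Jq; apply/JE; apply: JD.
- by move=> r p /JE Jp; apply/JE; apply: JM.
- by move=> i p /JE Jp; apply/JE; apply: Jd.
Qed.

Lemma ord_leW l l' (p : R) : (l <= l')%N -> ord_le l p -> ord_le l' p.
Proof. by move=> ll op k kp x xk; apply: leq_trans ll; apply: op xk. Qed.

Lemma ord_leD l (p q : R) : ord_le l p -> ord_le l q -> ord_le l (p + q).
Proof.
move=> op oq k /(fsubsetP (msuppD_le p q)); rewrite in_fsetU => /orP[kp|kq].
  exact: op.
exact: oq.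
Qed.

Lemma ord_leM l (p q : R) : ord_le l p -> ord_le l q -> ord_le l (p * q).
Proof.
move=> op oq k /msuppM_le [k1 [k2 [k1p k2q ->]]] x; rewrite mdomD in_fsetU.
by case/orP; [apply: op|apply: oq].
Qed.

Lemma ord_leU l c (k : mon) : (forall x, x \in finsupp k -> (ordv x <= l)%N) ->
  ord_le l (<< c *g k >> : R).
Proof. by move=> ok k' /(fsubsetP msuppU_le); rewrite in_fset1 => /eqP ->. Qed.

Lemma ord_leC l c : ord_le l (c%:MP : R).
Proof. by apply: ord_leU => x; rewrite mdom1. Qed.

Lemma ord_le_sum l (I : eqType) (r : seq I) (f : I -> R) :
  (forall x, x \in r -> ord_le l (f x)) -> ord_le l (\sum_(x <- r) f x).
Proof.
move=> of_; rewrite big_seq; apply: (big_ind (fun p => ord_le l p)) => //.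
  by rewrite -malgC0E; apply: ord_leC.
exact: ord_leD.
Qed.

Lemma ord_leB l (p q : R) : ord_le l p -> ord_le l q -> ord_le l (p - q).
Proof.
move=> op oq; apply: ord_leD => //.
by move=> k; rewrite msuppN; apply: oq.
Qed.

Lemma ord_leX l (p : R) r : ord_le l p -> ord_le l (p ^+ r).
Proof.
move=> op; elim: r => [|r IH]; first by rewrite expr0 -mpolyC1E; apply: ord_leC.
by rewrite exprS; apply: ord_leM.
Qed.

Lemma ord_le_Xv l (x : dvar n m) : (ordv x <= l)%N -> ord_le l (Xv F x).
Proof. by move=> ox; apply: ord_leU => y; rewrite mdomU in_fset1 => /eqP ->. Qed.

Lemma ordv_shiftv i (x : dvar n m) : ordv (shiftv i x) = (ordv x).+1.
Proof.
rewrite /ordv /=; under eq_bigr do rewrite ffunE.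
rewrite big_split /= [X in (_ + X)%N](bigD1 i) //= eqxx.
by rewrite [X in (1 + X)%N]big1 ?addn0 ?addn1 // => j /negPf ->.
Qed.

Lemma ord_le_dder l i (p : R) : ord_le l p -> ord_le l.+1 (dder der i p).
Proof.
move=> op; apply: ord_le_sum => k kp; have ok := op k kp.
apply: ord_leD; first by apply: ord_leU => x /ok /leqW.
rewrite -mul_malgC; apply: ord_leM; first exact: ord_leC.
apply: ord_le_sum => x xk; apply: ord_leM; last first.
  by apply: ord_le_Xv; rewrite ordv_shiftv ltnS; apply: ok.
apply: ord_leM; first by rewrite -mpolyC_nat; apply: ord_leC.
apply: ord_leU => y; rewrite -cmE_neq0 divcmE => y0; apply/leqW/ok.
by rewrite -cmE_neq0; apply: contraNneq y0 => ->.
Qed.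

Lemma dvar_ord_finite l : exists vs : seq (dvar n m),
  forall x, (ordv x <= l)%N -> x \in vs.
Proof.
exists [seq (u.1, [ffun j => nat_of_ord (u.2 j)]) |
  u : ('I_m * {ffun 'I_n -> 'I_l.+1})%type] => -[a mu] ox.
apply/imageP; exists (a, [ffun j => inord (mu j)]) => //=; congr (_, _).
apply/ffunP=> j; rewrite !ffunE inordK // ltnS; apply: leq_trans ox.
by rewrite /ordv (bigD1 j) //= leq_addr.
Qed.

(** Presents the polynomials of order at most [l] as the image of an iterated polynomial ring, where
    the chains of primes are built. *)
Lemma ord_le_generated l : exists N (y : nat -> R),
  (forall j, (j < N)%N -> exists2 x, (ordv x <= l)%N & y j = Xv F x) /\
  (forall g, ord_le l (ieval (@malgC mon F) y N g)) /\
  (forall p, ord_le l p -> exists g, ieval (@malgC mon F) y N g = p).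
Proof.
have [vs0 mem_vs0] := dvar_ord_finite l.
pose vs := [seq x <- vs0 | ordv x <= l]%N.
have mem_vs x : (ordv x <= l)%N -> x \in vs.
  by move=> ox; rewrite mem_filter ox mem_vs0.
exists (size vs), (nth 0 [seq Xv F x | x <- vs]); set ev := ieval _ _ _.
have vars j : (j < size vs)%N -> exists2 x, (ordv x <= l)%N &
    nth 0 [seq Xv F x | x <- vs] j = Xv F x.
  move=> lj; have /mapP[x xvs E] :
      nth 0 [seq Xv F x | x <- vs] j \in [seq Xv F x | x <- vs].
    by rewrite mem_nth // size_map.
  by exists x; [move: xvs; rewrite mem_filter => /andP[] | exact: E].
split; first exact: vars.
split.
  apply: ieval_closed => [a b|a b|c|j lj]; [exact: ord_leD|exact: ord_leM|exact: ord_leC|].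
  by have [x ox ->] := vars j lj; apply: ord_le_Xv.
have evX x : (ordv x <= l)%N -> exists g, ev g = Xv F x.
  move=> /mem_vs xvs; have lx : (index x vs < size vs)%N by rewrite index_mem.
  exists (ipolyX F (size vs) (index x vs)); rewrite /ev ieval_X //.
  by rewrite (nth_map x _ _ lx) (nth_index x xvs).
(* Monomials are reached by induction on the degree, splitting off one variable. *)
have evm d (k : mon) : mdeg k = d -> (forall x, x \in finsupp k -> (ordv x <= l)%N) ->
    exists g, ev g = << k >>.
  elim: d k => [|d IH] k; first by move/mdeg_eq0I => -> _; exists 1; exact: rmorph1.
  move=> dk ok; have [x xk] : exists x, x \in finsupp k.
    apply/fset0Pn; apply: contra_eqN dk => /eqP k0.
    by rewrite mdegE k0 big_seq_fset0.
  pose k' := divcm k (ucm x).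
  have kE : k = mmul (ucm x) k'.
    apply/eqP/cmP => y; rewrite cmM divcmE cmU subnKC //.
    by case: eqVneq => // <-; rewrite lt0n cmE_neq0.
  have [||g Eg] := IH k'.
  - by move: dk; rewrite kE mdegM mdegU add1n => -[].
  - by move=> y yk'; apply: ok; rewrite kE mdomD in_fsetU yk' orbT.
  have [gx Egx] := evX x (ok x xk).
  exists (gx * g); apply: etrans (rmorphM ev gx g) _; rewrite Eg Egx.
  exact: etrans (monalgU1M F (ucm x) k') (congr1 (fun z => << z >>) (esym kE)).
move=> p op; rewrite (monalgE p).
have : forall k, k \in (msupp p : seq mon) -> exists g, ev g = << p@_k *g k >>.
  move=> k kp; have [g Eg] := evm _ k erefl (op k kp).
  exists (ipolyC F _ p@_k * g); apply: etrans (rmorphM ev _ g) _.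
  rewrite Eg; apply: etrans (congr1 (fun z => z * _) (ieval_C _ _ _ _)) _.
  exact: esym (monalgUC _ _).
elim: (msupp p : seq mon) => [|k s IH] evk.
  by exists 0; rewrite big_nil; exact: rmorph0.
have [g Eg] := evk k (mem_head _ _).
have [|h Eh] := IH; first by move=> k' k's; apply: evk; rewrite inE k's orbT.
by exists (g + h); rewrite big_cons; apply: etrans (rmorphD ev g h) _; rewrite Eg Eh.
Qed.

End Derivation.

(** * Transfer of chains of primes through a localisation *)

Section ChainTransfer.

Variables (F : fieldType) (A B : comNzRingType).
Variables (fA : {rmorphism F -> A}) (fB : {rmorphism F -> B}).
Variables (S I : A -> Prop) (S' J : B -> Prop) (N : nat) (y : nat -> B) (q : B).
Local Notation ev := (ieval fB y N).

Hypothesis chF : [pchar F] =i pred0.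
Hypothesis SD : forall a b, S a -> S b -> S (a + b).
Hypothesis SM : forall a b, S a -> S b -> S (a * b).
Hypothesis Sf : forall c, S (fA c).
Hypothesis evS : forall g, S' (ev g).
Hypothesis S_ev : forall b, S' b -> exists g, ev g = b.
Hypothesis idJ : ideal_in J.
Hypothesis Sq : S' q.

(* [T p b r] reads: p corresponds to the fraction b / q^r. *)
Variable T : A -> B -> nat -> Prop.
Hypothesis TD : forall p b r p' b' r', T p b r -> T p' b' r' ->
  T (p + p') (b * q ^+ r' + b' * q ^+ r) (r + r').
Hypothesis TM : forall p b r p' b' r', T p b r -> T p' b' r' ->
  T (p * p') (b * b') (r + r').
Hypothesis TC : forall c, T (fA c) (fB c) 0.
Hypothesis Tq : T 1 q 1.
Hypothesis TJ : forall p b r, T p b r -> J b -> I p.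
Hypothesis TS : forall p, S p -> exists b r, S' b /\ T p b r.

(** The chain yields [d] elements independent modulo [I], which correspond to fractions over powers
    of [q]. These stay independent modulo a suitable prime above [J]; a chain of primes is built
    above it after inverting [q], then contracted to the subring [S']. *)
Lemma chain_transfer d (c : nat -> A -> Prop) :
  (forall k, (k <= d)%N -> prime_within S (c k) /\ forall p, I p /\ S p -> c k p) ->
  strict_chain c d ->
  exists c' : nat -> B -> Prop,
    (forall k, (k <= d)%N ->
      [/\ prime_within S' (c' k), c' k 0 & forall b, J b /\ S' b -> c' k b]) /\
    strict_chain c' d.
Proof.
move=> prc sc.
have [x [Sx indep]] := chain_alg_independent SD SM Sf (fun k lk => (prc k lk).1) sc.
have Sev g : S (ieval fA x d g) by apply: ieval_closed.
have nI g : g != 0 -> ~ I (ieval fA x d g).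
  move=> gn0 Ig; apply: (indep g gn0); exact: (prc 0%N isT).2.
have /boolp.choice [be Hbe] : forall j, exists z : ipoly F N * nat, (j < d)%N ->
    T (x j) (ev z.1) z.2.
  move=> j.
  case: (boolp.pselect (j < d)%N) => [lj|nlj]; last by exists (0, 0%N).
  have [b [r [/S_ev [g <-] Tg]]] := TS (Sx j lj).
  by exists (g, r).
have [qh Eqh] := S_ev Sq.
have [J0 JD JM] := idJ.
(* [P0] contains the preimage of [J] and avoids the numerators of all nonzero polynomials in [x]; by
   [TJ] and [nI] such a numerator is never in [J]. *)
have [||||P0 [prP JP MP]] := @exists_prime_avoiding (ipoly F N)
   (fun g => J (ev g))
   (fun g => exists f r, f != 0 /\ T (ieval fA x d f) (ev g) r).
- split; first by rewrite rmorph0.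
  + by move=> a b Ja Jb; rewrite rmorphD; apply: JD.
  + by move=> r a Ja; rewrite rmorphM; apply: JM.
- exists 1, 0%N; split; first exact: oner_neq0.
  by rewrite !rmorph1; have := TC 1; rewrite !rmorph1.
- move=> a b [f [r [fn0 Tf]]] [g [r' [gn0 Tg]]]; exists (f * g), (r + r')%N.
  by split; [exact: mulf_neq0 | rewrite !rmorphM; apply: TM].
- by move=> b Jb [f [r [fn0 /TJ /(_ Jb)]]]; apply: nI.
have [K [pi kerpi]] := residue_field prP.
have qn0 : pi qh != 0.
  apply/negP=> /eqP /kerpi /MP; apply; exists 1, 1%N; split; first exact: oner_neq0.
  by rewrite rmorph1 Eqh.
(* The extra variable stands for [1 / q], so [xi j] represents the fraction attached to [x j]. *)
pose eta : {rmorphism ipoly F N.+1 -> K} := adjoin pi (pi qh)^-1.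
have etaC g : eta g%:P = pi g by apply: adjoinC.
have etaX : eta 'X = (pi qh)^-1 by apply: adjoinX.
have etaMX (p : {poly ipoly F N}) a : eta (p * 'X + a%:P) = eta p / pi qh + pi a.
  by rewrite /eta rmorphD rmorphM adjoinX adjoinC.
pose xi j : ipoly F N.+1 := ((be j).1)%:P * 'X ^+ (be j).2.
have rep f : exists g r, T (ieval fA x d f) (ev g) r /\
    eta (ieval (ipolyC F N.+1) xi d f) = pi g / pi qh ^+ r.
  apply: (@ipoly_ind F d (fun f => exists g r, T (ieval fA x d f) (ev g) r /\
    eta (ieval (ipolyC F N.+1) xi d f) = pi g / pi qh ^+ r)).
  - move=> a b [g [r [Tg Eg]]] [g' [r' [Tg' Eg']]].
    exists (g * qh ^+ r' + g' * qh ^+ r), (r + r')%N; split.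
      rewrite rmorphD [ev _]rmorphD 2![ev (_ * _)]rmorphM 2![ev (_ ^+ _)]rmorphXn.
      by rewrite Eqh; apply: TD.
    rewrite 2!rmorphD Eg Eg' [pi (_ + _)]rmorphD 2![pi (_ * _)]rmorphM 2![pi (_ ^+ _)]rmorphXn.
    have q1 := expf_neq0 r qn0; have q2 := expf_neq0 r' qn0.
    by rewrite exprD; field; rewrite q1 q2.
  - move=> a b [g [r [Tg Eg]]] [g' [r' [Tg' Eg']]]; exists (g * g'), (r + r')%N.
    split; first by rewrite rmorphM [ev (_ * _)]rmorphM; apply: TM.
    by rewrite 2!rmorphM Eg Eg' [pi (_ * _)]rmorphM exprD mulf_div.
  - move=> e; exists (ipolyC F N e), 0%N; rewrite !ieval_C; split=> //.
    by rewrite [eta _]etaC expr0 divr1.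
  - move=> j lj; exists (be j).1, (be j).2; rewrite !ieval_X //; split; first exact: Hbe.
    by rewrite /xi rmorphM etaC rmorphXn etaX exprVn.
have [|Q [prQ sQ]] := @prime_chain_above_kernel F N.+1 d K eta xi chF.
  move=> g gn0; have [h [r [Th ->]]] := rep g.
  rewrite mulf_neq0 ?invr_neq0 ?expf_neq0 //; apply/negP=> /eqP /kerpi /MP; apply.
  by exists g, r.
have P0Q k g : (k <= d)%N -> P0 g -> Q k g%:P.
  by move=> lk /kerpi Pg; apply: (prQ k lk).2; rewrite etaC.
(* Every [Q k] contains the kernel of [ev], so membership of a polynomial free of the last variable
   depends only on its value. *)
have QE k g g' : (k <= d)%N -> ev g = ev g' -> Q k g%:P -> Q k g'%:P.
  move=> lk e Qg; have [[[_ QD _] _ _] _] := prQ k lk.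
  have -> : g'%:P = g%:P + (g' - g)%:P by rewrite -polyCD addrC subrK.
  by apply: QD => //; apply: P0Q => //; apply: JP; rewrite rmorphB e subrr.
(* [q] is invertible modulo the kernel of [eta]. *)
have Qq k M : (k <= d)%N -> ~ Q k ((qh ^+ M)%:P).
  move=> lk Qq; have [[[_ QD QM] Q1 _] kQ] := prQ k lk; apply: Q1.
  have -> : 1 = (1 - 'X ^+ M * (qh ^+ M)%:P) + 'X ^+ M * (qh ^+ M)%:P :> ipoly F N.+1.
    by rewrite subrK.
  apply: QD; last exact: QM.
  apply: kQ; rewrite rmorphB rmorph1 rmorphM rmorphXn etaX etaC rmorphXn.
  by rewrite -exprMn mulVf // expr1n subrr.
(* Multiplying by a power of [q] removes the last variable modulo the kernel of [eta]; this is why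
   contraction keeps inclusions strict. *)
have clear p : exists g M, eta p * pi qh ^+ M = pi g.
  elim/poly_ind: p => [|p a [g [M E]]]; first by exists 0, 0%N; rewrite !rmorph0 mul0r.
  exists (g + a * qh ^+ M.+1), M.+1.
  rewrite etaMX [RHS]rmorphD [pi (_ * _)]rmorphM rmorphXn -E exprS.
  by field.
exists (fun k b => exists g, ev g = b /\ Q k g%:P); split.
  move=> k lk; have [[[Q0 QD QM] Q1 QP] kQ] := prQ k lk; split; first split.
  - by move=> _ [g [<- _]]; apply: evS.
  - move=> _ _ [g [<- Qg]] [g' [<- Qg']]; exists (g + g'); rewrite rmorphD polyCD.
    by split=> //; apply: QD.
  - move=> b _ /S_ev [h <-] [g [<- Qg]]; exists (h * g); rewrite rmorphM polyCM.
    by split=> //; apply: QM.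
  - case=> g [Eg Qg]; apply: Q1; rewrite -[1]/(1%:P); apply: QE Qg => //.
    by rewrite Eg rmorph1.
  - move=> _ _ /S_ev [g <-] /S_ev [g' <-] [h [Eh Qh]].
    have /QP[Qg|Qg] : Q k (g%:P * g'%:P).
      by rewrite -polyCM; apply: QE Qh => //; rewrite Eh rmorphM.
    + by left; exists g.
    + by right; exists g'.
  - by exists 0; rewrite rmorph0 polyC0.
  - move=> b [Jb /S_ev [g Eg]]; exists g; split=> //; apply: P0Q => //.
    by apply: JP; rewrite Eg.
move=> k lk; have [sub [p [Qp nQp]]] := sQ k lk; split.
  by move=> b [g [Eg Qg]]; exists g; split=> //; apply: sub.
have [g [M Eg]] := clear p; exists (ev g).
have [[[_ QD QM] _ QP] kQ] := prQ k (ltnW lk).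
have [[[_ QD' QM'] _ _] kQ'] := prQ k.+1 lk.
have kern : eta (p * (qh ^+ M)%:P - g%:P) = 0.
  by rewrite rmorphB rmorphM !etaC rmorphXn Eg subrr.
split.
  exists g; split=> //.
  have -> : g%:P = (-1) * (p * (qh ^+ M)%:P - g%:P) + (qh ^+ M)%:P * p by ring.
  by apply: QD'; apply: QM' => //; apply: kQ'.
case=> h [Eh Qh]; have Qg := QE _ _ _ (ltnW lk) Eh Qh.
have /QP[//|] : Q k (p * (qh ^+ M)%:P).
  have -> : p * (qh ^+ M)%:P = (p * (qh ^+ M)%:P - g%:P) + g%:P by rewrite subrK.
  by apply: QD => //; apply: kQ.
exact: Qq (ltnW lk).
Qed.

End ChainTransfer.

(** * Correspondences between fractions *)

Section Fractions.

Variables (A : comNzRingType) (I : A -> Prop).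
Hypothesis idI : ideal_in I.

(** This and the next definitions restate [nzd_mod], [frac_eq] and the operations on fractions over
    an arbitrary commutative ring. *)
Definition nzd (a : A) : Prop := forall b, I (a * b) -> I b.
Definition feq (x y : A * A) : Prop := I (x.1 * y.2 - y.1 * x.2).
Definition fadd (x y : A * A) : A * A := (x.1 * y.2 + y.1 * x.2, x.2 * y.2).
Definition fmul (x y : A * A) : A * A := (x.1 * y.1, x.2 * y.2).
Definition fscale (s : A -> A) (x : A * A) : A * A := (s x.1, x.2).
Definition fder (D : A -> A) (x : A * A) : A * A :=
  (D x.1 * x.2 - x.1 * D x.2, x.2 * x.2).

Lemma ideal_comb a b u v : I u -> I v -> I (a * u + b * v).
Proof. by move=> Iu Iv; have [_ ID IM] := idI; apply: ID; apply: IM. Qed.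

Lemma nzd1 : nzd 1.
Proof. by move=> b; rewrite mul1r. Qed.

Lemma nzdM a b : nzd a -> nzd b -> nzd (a * b).
Proof. by move=> na nb c; rewrite -mulrA => /na /nb. Qed.

Lemma nzdX a r : nzd a -> nzd (a ^+ r).
Proof.
by move=> na; elim: r => [|r IH]; [exact: nzd1 | rewrite exprS; apply: nzdM].
Qed.

Lemma feq_refl x : feq x x.
Proof. by rewrite /feq subrr; case: idI. Qed.

Lemma feq_sym x y : feq x y -> feq y x.
Proof.
move=> e; rewrite /feq; have [_ _ IM] := idI.
have -> : y.1 * x.2 - x.1 * y.2 = -1 * (x.1 * y.2 - y.1 * x.2) by ring.
exact: IM.
Qed.

(** The middle denominator is cancelled, hence the condition on [y.2]. *)
Lemma feq_trans x y z : nzd y.2 -> feq x y -> feq y z -> feq x z.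
Proof.
move=> ny exy eyz; apply: ny.
have -> : y.2 * (x.1 * z.2 - z.1 * x.2) =
  z.2 * (x.1 * y.2 - y.1 * x.2) + x.2 * (y.1 * z.2 - z.1 * y.2) by ring.
exact: ideal_comb.
Qed.

Lemma feq_add x x' y y' : feq x y -> feq x' y' -> feq (fadd x x') (fadd y y').
Proof.
move=> e e'; rewrite /feq /fadd /=.
have -> : (x.1 * x'.2 + x'.1 * x.2) * (y.2 * y'.2) -
    (y.1 * y'.2 + y'.1 * y.2) * (x.2 * x'.2) =
  (x'.2 * y'.2) * (x.1 * y.2 - y.1 * x.2) +
  (x.2 * y.2) * (x'.1 * y'.2 - y'.1 * x'.2) by ring.
exact: ideal_comb.
Qed.

Lemma feq_mul x x' y y' : feq x y -> feq x' y' -> feq (fmul x x') (fmul y y').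
Proof.
move=> e e'; rewrite /feq /fmul /=.
have -> : x.1 * x'.1 * (y.2 * y'.2) - y.1 * y'.1 * (x.2 * x'.2) =
  (x'.1 * y'.2) * (x.1 * y.2 - y.1 * x.2) +
  (y.1 * x.2) * (x'.1 * y'.2 - y'.1 * x'.2) by ring.
exact: ideal_comb.
Qed.

Lemma feq_scale (s : A -> A) x y : (forall a b, s a * b = s 1 * (a * b)) ->
  feq x y -> feq (fscale s x) (fscale s y).
Proof.
move=> sE e; rewrite /feq /fscale /= (sE x.1) (sE y.1) -mulrBr.
by have [_ _] := idI; apply.
Qed.

(** The difference of [x] and [y] is [w / (x.2 * y.2)]; the numerator of its derivative,
    [x.2 y.2 D(w) - D(x.2 y.2) w], lies in [I] along with [w] and [D(w)]. *)
Lemma feq_der (D : A -> A) x y :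
  (forall a b, D (a - b) = D a - D b) -> (forall a b, D (a * b) = D a * b + a * D b) ->
  (forall a, I a -> I (D a)) -> feq x y -> feq (fder D x) (fder D y).
Proof.
move=> DB DM DI e; rewrite /feq /fder /=.
have De := DI _ e; rewrite DB !DM in De.
set w := x.1 * y.2 - y.1 * x.2 in e *.
have -> : (D x.1 * x.2 - x.1 * D x.2) * (y.2 * y.2) -
    (D y.1 * y.2 - y.1 * D y.2) * (x.2 * x.2) =
  (x.2 * y.2) * (D x.1 * y.2 + x.1 * D y.2 - (D y.1 * x.2 + y.1 * D x.2)) +
  (- D x.2 * y.2 - x.2 * D y.2) * w by rewrite /w; ring.
exact: ideal_comb.
Qed.

End Fractions.

(* The symmetric form of a differential birational map: the relation
   "phi x = y" between fractions, up to equality in the quotient rings. *)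
Record fcorr (F : Type) (n : nat) (A B : comNzRingType) (I : A -> Prop)
    (J : B -> Prop) (sA : F -> A -> A) (sB : F -> B -> B)
    (dA : 'I_n -> A -> A) (dB : 'I_n -> B -> B)
    (C : A * A -> B * B -> Prop) : Prop := FCorr {
  fc_okl : forall x y, C x y -> nzd I x.2;
  fc_okr : forall x y, C x y -> nzd J y.2;
  fc_left : forall x, nzd I x.2 -> exists y, C x y;
  fc_right : forall y, nzd J y.2 -> exists x, C x y;
  fc_eql : forall x x' y, C x y -> nzd I x'.2 -> feq I x x' -> C x' y;
  fc_eqr : forall x y y', C x y -> nzd J y'.2 -> feq J y y' -> C x y';
  fc_inj : forall x y x' y', C x y -> C x' y' -> feq I x x' <-> feq J y y';
  fc_add : forall x y x' y', C x y -> C x' y' -> C (fadd x x') (fadd y y');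
  fc_mul : forall x y x' y', C x y -> C x' y' -> C (fmul x x') (fmul y y');
  fc_scale : forall c x y, C x y -> C (fscale (sA c) x) (fscale (sB c) y);
  fc_one : C (1, 1) (1, 1);
  fc_der : forall i x y, C x y -> C (fder (dA i) x) (fder (dB i) y)
}.

Lemma fcorr_sym (F : Type) (n : nat) (A B : comNzRingType) (I : A -> Prop)
    (J : B -> Prop) (sA : F -> A -> A) (sB : F -> B -> B)
    (dA : 'I_n -> A -> A) (dB : 'I_n -> B -> B) (C : A * A -> B * B -> Prop) :
  fcorr I J sA sB dA dB C -> fcorr J I sB sA dB dA (fun y x => C x y).
Proof.
case=> okl okr l r el er inj add mul sc one dr; split=> //.
- by move=> x y; apply: okr.
- by move=> x y; apply: okl.
- by move=> x x' y; apply: er.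
- by move=> x y y'; apply: el.
- by move=> x y x' y' c c'; have [h1 h2] := inj _ _ _ _ c c'; split.
- by move=> x y x' y'; apply: add.
- by move=> x y x' y'; apply: mul.
- by move=> c x y; apply: sc.
- by move=> i x y; apply: dr.
Qed.

Lemma fcorr_of_map (F : Type) (n : nat) (A B : comNzRingType) (I : A -> Prop)
    (J : B -> Prop) (sA : F -> A -> A) (sB : F -> B -> B)
    (dA : 'I_n -> A -> A) (dB : 'I_n -> B -> B) (phi : A * A -> B * B) :
  ideal_in I -> ideal_in J ->
  (forall c a b, sB c a * b = sB c 1 * (a * b)) ->
  (forall i a b, dB i (a - b) = dB i a - dB i b) ->
  (forall i a b, dB i (a * b) = dB i a * b + a * dB i b) ->
  (forall i a, J a -> J (dB i a)) ->
  (forall x, nzd I x.2 -> nzd J (phi x).2) ->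
  (forall x y, nzd I x.2 -> nzd I y.2 -> feq I x y <-> feq J (phi x) (phi y)) ->
  (forall y, nzd J y.2 -> exists2 x, nzd I x.2 & feq J (phi x) y) ->
  (forall x y, nzd I x.2 -> nzd I y.2 ->
    feq J (phi (fadd x y)) (fadd (phi x) (phi y)) /\
    feq J (phi (fmul x y)) (fmul (phi x) (phi y))) ->
  (forall c x, nzd I x.2 -> feq J (phi (fscale (sA c) x)) (fscale (sB c) (phi x))) ->
  feq J (phi (1, 1)) (1, 1) ->
  (forall i x, nzd I x.2 -> feq J (phi (fder (dA i) x)) (fder (dB i) (phi x))) ->
  fcorr I J sA sB dA dB (fun x y => [/\ nzd I x.2, nzd J y.2 & feq J (phi x) y]).
Proof.
move=> idI idJ sBE dBB dBM dBJ ok inj sur ring_ sc one dr; split.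
- by move=> x y [].
- by move=> x y [].
- move=> x nx; exists (phi x); split=> //; [exact: ok|exact: feq_refl].
- by move=> y ny; have [x nx e] := sur y ny; exists x.
- move=> x x' y [nx ny e] nx' exx'; split=> //.
  apply: (feq_trans idJ (ok x nx)) => //; apply: (feq_sym idJ).
  exact/(inj _ _ nx nx').
- move=> x y y' [nx ny e] ny' eyy'; split=> //.
  exact: (feq_trans idJ ny).
- move=> x y x' y' [nx ny e] [nx' ny' e']; split.
    move=> /(inj _ _ nx nx') exx'.
    apply: (feq_trans idJ (ok x nx)); first exact: feq_sym.
    by apply: (feq_trans idJ (ok x' nx')).
  move=> eyy'; apply/(inj _ _ nx nx').
  apply: (feq_trans idJ ny) => //; apply: (feq_trans idJ ny') => //.
  exact: feq_sym.
- move=> x y x' y' [nx ny e] [nx' ny' e']; split; try exact: nzdM.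
  apply: (feq_trans idJ _ (ring_ _ _ nx nx').1); first by apply: nzdM; apply: ok.
  exact: feq_add.
- move=> x y x' y' [nx ny e] [nx' ny' e']; split; try exact: nzdM.
  apply: (feq_trans idJ _ (ring_ _ _ nx nx').2); first by apply: nzdM; apply: ok.
  exact: feq_mul.
- move=> c x y [nx ny e]; split=> //.
  apply: (feq_trans idJ _ (sc c x nx)); first exact: ok.
  exact: feq_scale.
- by split=> //; apply: nzd1.
- move=> i x y [nx ny e]; split; try exact: nzdM.
  apply: (feq_trans idJ _ (dr i x nx)); first by apply: nzdM; apply: ok.
  exact: (feq_der idJ (dBB i) (dBM i) (dBJ i) e).
Qed.

(** * Fractions over powers of a fixed denominator *)

Section PowerDenominators.

Variables (F : Type) (n : nat) (A B : comNzRingType) (I : A -> Prop) (J : B -> Prop).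
Variables (sA : F -> A -> A) (sB : F -> B -> B).
Variables (dA : 'I_n -> A -> A) (dB : 'I_n -> B -> B) (C : A * A -> B * B -> Prop).
Hypothesis fcC : fcorr I J sA sB dA dB C.
Hypothesis idJ : ideal_in J.
Variable q : B.

Definition qfrac (p : A) (b : B) (r : nat) : Prop := C (p, 1) (b, q ^+ r).

Lemma qfracD p b r p' b' r' : qfrac p b r -> qfrac p' b' r' ->
  qfrac (p + p') (b * q ^+ r' + b' * q ^+ r) (r + r').
Proof.
by move=> c c'; have := fc_add fcC c c'; rewrite /fadd /= !mulr1 -exprD.
Qed.

Lemma qfracM p b r p' b' r' : qfrac p b r -> qfrac p' b' r' ->
  qfrac (p * p') (b * b') (r + r').
Proof.
by move=> c c'; have := fc_mul fcC c c'; rewrite /fmul /= !mulr1 -exprD.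
Qed.

Lemma qfracC c : qfrac (sA c 1) (sB c 1) 0.
Proof. exact: (fc_scale fcC c (fc_one fcC)). Qed.

Lemma qfrac1 : nzd J q -> qfrac 1 q 1.
Proof.
move=> nq; apply: (fc_eqr fcC (fc_one fcC)); first exact: nzdX.
by rewrite /feq /= expr1 mul1r mulr1 subrr; case: idJ.
Qed.

(** Scaling by a [c] that acts as zero makes the zero fractions correspond; injectivity then carries
    [b / q^r = 0] back to [p = 0]. *)
Lemma qfrac_ideal c p b r : sA c 1 = 0 -> sB c 1 = 0 -> qfrac p b r -> J b -> I p.
Proof.
move=> a0 b0 cb Jb.
have c0 : C (0, 1) (0, 1) by have := qfracC c; rewrite a0 b0.
have /(fc_inj fcC cb c0) : feq J (b, q ^+ r) (0, 1).
  by rewrite /feq /= mulr1 mul0r subr0.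
by rewrite /feq /= mulr1 mul0r subr0.
Qed.

Lemma qfrac_der i p b r : dA i 1 = 0 -> qfrac p b r ->
  qfrac (dA i p) (dB i b * q ^+ r - b * dB i (q ^+ r)) (r + r).
Proof.
move=> d1 c; have := fc_der fcC i c.
by rewrite /fder /= d1 !mulr1 mulr0 subr0 -exprD.
Qed.

Lemma qfrac_common p a b s : nzd J q -> C (p, 1) (a, s) -> a * q = b * s ->
  qfrac p b 1.
Proof.
move=> nq c e; apply: (fc_eqr fcC c); first exact: nzdX.
by rewrite /feq /= expr1 e subrr; case: idJ.
Qed.

End PowerDenominators.

(** * Bounded shift of orders under a birational map *)

Section OrderShift.

Variables (F : fieldType) (n : nat) (der : 'I_n -> F -> F).
Hypothesis derP : is_diff_field der.

Lemma diff_birational_fcorr m k (I : DP F n m -> Prop) (J : DP F n k -> Prop) phi :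
  is_dideal der I -> is_dideal der J -> diff_birational der I J phi ->
  fcorr I J (fun c p => c *: p) (fun c p => c *: p)
    (fun i => dder der i) (fun i => dder der i)
    (fun x y => [/\ nzd I x.2, nzd J y.2 & feq J (phi x) y]).
Proof.
move=> [idI _] [idJ dJ] [ok inj sur ring_ [sc one dr]].
apply: fcorr_of_map.
- exact: idI.
- exact: idJ.
- by move=> c a b; rewrite -[in LHS]mul_malgC -malgC_scale1; apply/esym/mulrA.
- exact: dderB.
- exact: dderM.
- exact: dJ.
- exact: ok.
- exact: inj.
- exact: sur.
- exact: ring_.
- exact: sc.
- exact: one.
- exact: dr.
Qed.

Lemma uniform_bound (T : eqType) (s : seq T) (P : T -> nat -> Prop) :
  (forall x l l', (l <= l')%N -> P x l -> P x l') -> (forall x, exists l, P x l) ->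
  exists l, forall x, x \in s -> P x l.
Proof.
move=> mono ex; elim: s => [|x s [l Hl]]; first by exists 0%N.
have [l' Hl'] := ex x; exists (maxn l l') => z; rewrite inE => /predU1P[->|/Hl Hz].
  exact: mono (leq_maxr _ _) Hl'.
exact: mono (leq_maxl _ _) Hz.
Qed.

Lemma ord_le_exists m (p : DP F n m) : exists l, ord_le l p.
Proof.
apply: (@uniform_bound _ (enum_fset (msupp p))
  ( fun k l => forall x, x \in finsupp k -> (ordv x <= l)%N)).
  by move=> k l l' ll Hk x /Hk /leq_trans; apply.
move=> k; apply: (@uniform_bound _ (enum_fset (finsupp k))
  ( fun x l => (ordv x <= l)%N)) => [x l l' ll /leq_trans|x]; first exact.
by exists (ordv x).
Qed.

Lemma ord_le_common m (T : finType) (f : T -> DP F n m) :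
  exists l, forall t, ord_le l (f t).
Proof.
have [t l l'|t|l Hl] := @uniform_bound T (enum T) (fun t l => ord_le l (f t)).
- exact: ord_leW.
- exact: ord_le_exists.
- by exists l => t; apply: Hl; rewrite mem_enum.
Qed.

Lemma dvar_shiftP m (x : dvar n m) t : ordv x = t.+1 ->
  exists i x', x = shiftv i x' /\ ordv x' = t.
Proof.
move=> ox; have [i xi] : exists i, (0 < x.2 i)%N.
  apply/existsP; rewrite -[X in is_true X]negbK negb_exists; apply/negP => /forallP x0.
  move: ox; rewrite /ordv big1 // => i _; apply/eqP.
  by have := x0 i; rewrite -eqn0Ngt.
pose x' : dvar n m := (x.1, [ffun j => (x.2 j - (j == i))%N]).
have E : x = shiftv i x'.
  case: x ox xi @x' => a mu /= ox xi; congr (_, _); apply/ffunP=> j; rewrite !ffunE.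
  by case: eqVneq => [->|_]; rewrite ?subnK // subn0 addn0.
by exists i, x'; split=> //; move: ox; rewrite {1}E ordv_shiftv => -[].
Qed.

Variables (m k : nat) (I : DP F n m -> Prop) (J : DP F n k -> Prop).
Variable C : DP F n m * DP F n m -> DP F n k * DP F n k -> Prop.
Hypothesis idJ : is_ideal J.
Hypothesis fcC : fcorr I J (fun c p => c *: p) (fun c p => c *: p)
    (fun i => dder der i) (fun i => dder der i) C.

(** The shift [l0] bounds the orders of [q] and of the numerators of the images of the
    indeterminates. Each derivation costs one order on both sides, while sums and products cost
    none. *)
Lemma qfrac_order_shift : exists l0 q, [/\ ord_le l0 q, nzd J q &
  forall l p, ord_le l p -> exists b r, ord_le (l + l0) b /\ qfrac C q p b r].
Proof.
pose v0 (u : 'I_m) : dvar n m := (u, [ffun=> 0%N]).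
have /boolp.choice [a Ha] : forall u, exists y, C (Xv F (v0 u), 1) y.
  by move=> u; apply: (fc_left fcC); apply: nzd1.
pose q := \prod_u (a u).2.
(* The numerator of the image of [u] over the common denominator [q]. *)
pose b u := (a u).1 * \prod_(v | v != u) (a v).2.
have nq : nzd J q.
  rewrite /q; apply: (big_ind (nzd J)); [exact: nzd1|exact: nzdM|].
  by move=> u _; exact: (fc_okr fcC (Ha u)).
have Hb u : qfrac C q (Xv F (v0 u)) (b u) 1.
  apply: (qfrac_common fcC idJ nq (a := (a u).1) (s := (a u).2)).
    by case: (a u) (Ha u).
  rewrite /q (bigD1 u isT) /b.
  have comm (R : comNzRingType) (x y z : R) : x * (y * z) = x * z * y by ring.
  exact: comm.
have [l1 ob] := ord_le_common b.
have [l2 oq] := ord_le_exists q.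
pose l0 := maxn l1 l2.
have {}ob u : ord_le l0 (b u) by apply: ord_leW (ob u); apply: leq_maxl.
have {}oq : ord_le l0 q by apply: ord_leW oq; apply: leq_maxr.
exists l0, q; split; [exact: oq|exact: nq|].
(* By the quotient rule the denominator remains a power of [q]; since all powers of [q] have order
   at most [l0], the numerator gains at most one order. *)
have var t (x : dvar n m) : ordv x = t -> exists b r,
    ord_le (t + l0) b /\ qfrac C q (Xv F x) b r.
  elim: t x => [|t IH] x ox.
    have -> : x = v0 x.1.
      case: x ox => u mu /eqP; rewrite /ordv sum_nat_eq0 => /forallP mu0.
      congr (_, _); apply/ffunP=> j; rewrite ffunE; apply/eqP; exact: (mu0 j).
    by exists (b x.1), 1%N; split; [exact: ob|exact: Hb].
  have [i [x' [-> ox']]] := dvar_shiftP ox.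
  have [c [r [oc qc]]] := IH x' ox'.
  have := qfrac_der fcC (i := i) (dder1 m derP i) qc.
  rewrite (dder_Xv derP i x') => qd.
  exists (dder der i c * q ^+ r - c * dder der i (q ^+ r)), (r + r)%N.
  split; last exact: qd.
  have oqr : ord_le (t + l0) (q ^+ r).
    by apply: ord_leX; apply: ord_leW oq; apply: leq_addl.
  rewrite addSn; apply: ord_leB; apply: ord_leM.
  - exact: ord_le_dder.
  - exact: ord_leW (leqnSn _) oqr.
  - exact: ord_leW (leqnSn _) oc.
  - exact: ord_le_dder.
move=> l p op; have [N [y [Hy [_ gen]]]] := ord_le_generated F n m l.
have [g <-] := gen p op.
apply: (@ieval_closed F _ _ (fun p => exists b r,
  ord_le (l + l0) b /\ qfrac C q p b r)) => [p1 p2|p1 p2|c|j lj].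
- move=> [b1 [r1 [o1 q1]]] [b2 [r2 [o2 q2]]].
  exists (b1 * q ^+ r2 + b2 * q ^+ r1), (r1 + r2)%N; split; last exact: (qfracD fcC q1 q2).
  have oqr r : ord_le (l + l0) (q ^+ r).
    by apply: ord_leX; apply: ord_leW oq; apply: leq_addl.
  by apply: ord_leD; apply: ord_leM; [exact: o1|exact: oqr|exact: o2|exact: oqr].
- move=> [b1 [r1 [o1 q1]]] [b2 [r2 [o2 q2]]].
  by exists (b1 * b2), (r1 + r2)%N; split; [exact: ord_leM|exact: (qfracM fcC q1 q2)].
- exists c%:MP, 0%N; split; first exact: ord_leC.
  have := qfracC fcC q c; rewrite -!malgC_scale1; exact.
- have [x ox ->] := Hy j lj; have [b' [r [o' q']]] := var _ x erefl.
  exists b', r; split; last exact: q'.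
  by apply: ord_leW o'; rewrite leq_add2r.
Qed.

Lemma krull_chain_order_shift : exists l0, forall l d,
  krull_chain (ord_le l) (fun p => I p /\ ord_le l p) d ->
  krull_chain (ord_le (l + l0)) (fun p => J p /\ ord_le (l + l0) p) d.
Proof.
have [l0 [q [oq nq HT]]] := qfrac_order_shift.
exists l0 => l d [c [prc sc]].
have [N [y [_ [evS gen]]]] := ord_le_generated F n k (l + l0).
have [chF _ _ _] := derP.
have [c' [prc' sc']] : exists c' : nat -> DP F n k -> Prop,
    (forall i, (i <= d)%N -> [/\ prime_within (ord_le (l + l0)) (c' i), c' i 0 &
      forall b, J b /\ ord_le (l + l0) b -> c' i b]) /\ strict_chain c' d.
  apply: (@chain_transfer F _ _ _ _ (ord_le l) I _ J N y q chF _ _ _ evS gen idJ _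
    (qfrac C q) _ _ _ _ _ _ d c _ sc).
  - by move=> a b; apply: ord_leD.
  - by move=> a b; apply: ord_leM.
  - by move=> e; apply: ord_leC.
  - by apply: ord_leW oq; apply: leq_addl.
  - by move=> p b r p' b' r'; apply: (qfracD fcC).
  - by move=> p b r p' b' r'; apply: (qfracM fcC).
  - by move=> e; have := qfracC fcC q e; rewrite -!malgC_scale1; exact.
  - exact: (qfrac1 fcC).
  - by move=> p b r; apply: (qfrac_ideal fcC (c := 0)); apply: scale0r.
  - by move=> p /HT [b [r [ob qb]]]; exists b, r.
  - move=> i li; have [[[sS _ sD sM] s1 sP] IJ] := prc i li; split; last exact: IJ.
    by split.
exists c'; split; last exact: sc'.
move=> i li; have [[sS sD sM s1 sP] c0 IJ] := prc' i li; split; last exact: IJ.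
by split.
Qed.

End OrderShift.

(** * Comparison of numerical polynomials *)

Section NumericalPolynomials.

Implicit Types p q : {poly rat}.

(** Induction on the Horner form; half the leading coefficient is a lower bound that survives
    multiplication by a large [l] and addition of a constant. *)
Lemma lead_coef_gt0_bound p : 0 < lead_coef p ->
  exists N : nat, forall l : nat, (N <= l)%N -> lead_coef p / 2 <= p.[l%:R].
Proof.
elim/poly_ind: p => [|p c IH]; first by rewrite lead_coef0 ltxx.
have [->|pn0] := eqVneq p 0.
  by rewrite mul0r add0r lead_coefC => c0; exists 0%N => l _; rewrite hornerC; lra.
have -> : lead_coef (p * 'X + c%:P) = lead_coef p.
  rewrite lead_coefDl ?lead_coefMX // size_mulX // (leq_ltn_trans (size_polyC_leq1 c)) //.
  by rewrite ltnS size_poly_gt0.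
set a := lead_coef p => a0; have [N HN] := IH a0.
(* Chosen so that [a / 2 * B = a / 2 + |c|]. *)
pose B := 1 + 2 * `|c| / a.
have B0 : 0 <= B by rewrite addr_ge0 // divr_ge0 // ?mulr_ge0 // ltW.
exists (maxn N (Num.bound B)) => l; rewrite geq_max => /andP[/HN pl Bl].
have lB : B <= l%:R.
  by apply: le_trans (ltW (archi_boundP B0)) _; rewrite ler_nat.
rewrite !hornerE.
have aB : a * B = a + 2 * `|c| by rewrite /B; field; rewrite gt_eqF.
have l0 : 0 <= l%:R :> rat by exact: ler0n.
have h1 : a / 2 * l%:R <= p.[l%:R] * l%:R by apply: ler_wpM2r.
have h2 : a * B <= a * l%:R by rewrite ler_pM2l.
have h3 : - c <= `|c| by rewrite -normrN ler_norm.
have : a * l%:R = 2 * (a / 2 * l%:R) by field.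
by lra.
Qed.

Lemma lead_coef_ge0 p N :
  (forall l : nat, (N <= l)%N -> 0 <= p.[l%:R]) -> 0 <= lead_coef p.
Proof.
move=> pos; rewrite leNgt; apply/negP => neg.
have ngt : 0 < lead_coef (- p) by rewrite lead_coefN oppr_gt0.
have [M HM] := lead_coef_gt0_bound ngt.
have := HM _ (leq_maxr N M); have := pos _ (leq_maxl N M).
by rewrite hornerN; lra.
Qed.

(** Translating the variable by [c] changes neither the size nor the leading coefficient of [q], and
    the leading coefficient of an eventually nonnegative difference is nonnegative. *)
Lemma dominated_lead_coef p q N c :
  (forall l : nat, (N <= l)%N -> 0 <= p.[l%:R] <= q.[(l + c)%:R]) ->
  (size p <= size q)%N /\ (size p = size q -> lead_coef p <= lead_coef q).
Proof.
move=> dom; pose q' := q \Po ('X + c%:R%:P).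
have szX : size ('X + c%:R%:P : {poly rat}) = 2 by rewrite size_XaddC.
have szq : size q' = size q by rewrite size_comp_poly2.
have lq : lead_coef q' = lead_coef q.
  by rewrite lead_coef_comp ?szX // lead_coefXaddC expr1n mulr1.
have r0 : 0 <= lead_coef (q' - p).
  apply: (@lead_coef_ge0 _ N) => l /dom /andP[_ le].
  by rewrite hornerD hornerN horner_comp hornerD hornerX hornerC -natrD subr_ge0.
have p0 : 0 <= lead_coef p by apply: (@lead_coef_ge0 _ N) => l /dom /andP[].
split.
  rewrite leqNgt; apply/negP => lt.
  move: r0; rewrite lead_coefDr ?size_polyN ?szq // lead_coefN oppr_ge0 => r0.
  have /eqP : lead_coef p = 0 by apply/le_anti; rewrite r0.
  by rewrite lead_coef_eq0 => /eqP p0'; move: lt; rewrite p0' size_poly0.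
move=> e; rewrite leNgt; apply/negP => lt.
have co : (q' - p)`_(size p).-1 = lead_coef q - lead_coef p.
  by rewrite coefB -lq !lead_coefE szq e.
have co0 : (q' - p)`_(size p).-1 < 0 by rewrite co subr_lt0.
have sp : (0 < size p)%N.
  rewrite lt0n size_poly_eq0; apply/negP => /eqP p00; move: e lt.
  rewrite p00 size_poly0 => /esym/eqP; rewrite size_poly_eq0 => /eqP ->.
  by rewrite ltxx.
have sr : size (q' - p) = size p.
  apply/eqP; rewrite eqn_leq; apply/andP; split.
    by rewrite (leq_trans (size_polyD _ _)) // size_polyN szq e maxnn.
  rewrite leqNgt; apply/negP => s.
  by move: co0; rewrite nth_default ?ltxx // -ltnS prednK.
by move: r0; rewrite lead_coefE sr leNgt co0.
Qed.

Lemma size_binpoly i : size (binpoly i) = i.+1.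
Proof.
elim: i => [|i IH]; first by rewrite /binpoly big_ord0 size_poly1.
have E : binpoly i.+1 = binpoly i * (('X + i.+1%:R%:P) * (i.+1%:R^-1)%:P).
  by rewrite /binpoly big_ord_recr.
have nz : (i.+1%:R^-1 : rat) != 0 by rewrite invr_eq0 pnatr_eq0.
have sz : size (('X + i.+1%:R%:P) * (i.+1%:R^-1)%:P : {poly rat}) = 2.
  by rewrite mulrC mul_polyC size_scale // size_XaddC.
rewrite E size_mul ?IH ?sz ?addn2 //.
  by rewrite -size_poly_eq0 IH.
by rewrite -size_poly_eq0 sz.
Qed.

(** The family [binpoly] is triangular. By descending induction the coordinates above the degree of
    [w] vanish, so only the term of index [i] reaches the coefficient of ['X^i]. *)
Lemma binpoly_coef n (a : 'I_n.+1 -> int) (w : {poly rat}) (i : 'I_n.+1) :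
  w = \sum_(i < n.+1) (a i)%:~R *: binpoly i -> ((size w).-1 <= i)%N ->
  w`_i = (a i)%:~R * lead_coef (binpoly i).
Proof.
move=> wE; have [t] := ubnP (n - i); elim: t i => // t IH i ti wi.
rewrite {1}wE coef_sum (bigD1 i) //= coefZ lead_coefE size_binpoly.
rewrite big1 ?addr0 // => j ji; rewrite coefZ.
have [lt|ge] := ltnP j i; first by rewrite nth_default ?mulr0 // size_binpoly.
have {ge ji} lt : (i < j)%N by rewrite ltn_neqAle eq_sym ji ge.
have lej : (size w <= j)%N by lia.
have := IH j; rewrite nth_default // => /(_ _ _)/esym/eqP; rewrite mulf_eq0.
rewrite lead_coef_eq0 -size_poly_eq0 size_binpoly orbF => H.
have /eqP -> : ((a j)%:~R == 0 :> rat).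
  by apply: H; [have := ltn_ord j; lia | lia].
by rewrite mul0r.
Qed.

End NumericalPolynomials.

(** * Comparison of the dimension polynomials *)

Lemma krull_chain_trunc (F : fieldType) n m (S J : DP F n m -> Prop) d d' :
  (d' <= d)%N -> krull_chain S J d -> krull_chain S J d'.
Proof.
move=> le [c [pr sc]]; exists c; split=> k lk.
  exact: pr (leq_trans lk le).
exact: sc (leq_trans lk le).
Qed.

(** [krull_dim] excludes chains of length [d' + 1] exactly; a longer transferred chain would
    truncate to that length. *)
Lemma dim_poly_dominated (F : fieldType) n m k (I : DP F n m -> Prop)
    (J : DP F n k -> Prop) (p q : {poly rat}) l0 :
  (forall l d, krull_chain (ord_le l) (fun p => I p /\ ord_le l p) d ->
    krull_chain (ord_le (l + l0)) (fun p => J p /\ ord_le (l + l0) p) d) ->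
  is_dim_poly I p -> is_dim_poly J q ->
  exists N, forall l : nat, (N <= l)%N -> 0 <= p.[l%:R] <= q.[(l + l0)%:R].
Proof.
move=> shift [N HN] [M HM]; exists (maxn N M) => l; rewrite geq_max => /andP[Nl Ml].
have [d [[chd _] ->]] := HN l Nl.
have [d' [[_ nch] ->]] := HM (l + l0)%N (leq_trans Ml (leq_addr _ _)).
rewrite ler0n /= ler_nat leqNgt; apply/negP => lt; apply: nch.
exact: krull_chain_trunc lt (shift _ _ chd).
Qed.

Theorem theorem1 (F : fieldType) (n : nat) (der : 'I_n -> F -> F)
  (m k : nat) (I : DP F n m -> Prop) (J : DP F n k -> Prop)
  (phi : dfrac F n m -> dfrac F n k)
  (omegaI omegaJ : {poly rat}) (a b : 'I_n.+1 -> int) :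
  is_diff_field der ->
  characterizable der I -> characterizable der J ->
  diff_birational der I J phi ->
  is_dim_poly I omegaI -> is_dim_poly J omegaJ ->
  omegaI = \sum_(i < n.+1) (a i)%:~R *: binpoly i ->
  omegaJ = \sum_(i < n.+1) (b i)%:~R *: binpoly i ->
  size omegaI = size omegaJ /\
  forall i : 'I_n.+1, ((size omegaI).-1 <= i)%N -> a i = b i.
Proof.
move=> derP /(characterizable_dideal derP) dI /(characterizable_dideal derP) dJ.
move=> bir dimI dimJ EI EJ.
have fc := diff_birational_fcorr derP dI dJ bir.
have [l0 sIJ] := krull_chain_order_shift derP dJ.1 fc.
have [l1 sJI] := krull_chain_order_shift derP dI.1 (fcorr_sym fc).
have [N /dominated_lead_coef [sz1 lc1]] := dim_poly_dominated sIJ dimI dimJ.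
have [M /dominated_lead_coef [sz2 lc2]] := dim_poly_dominated sJI dimJ dimI.
have sz : size omegaI = size omegaJ by apply/eqP; rewrite eqn_leq sz1 sz2.
have lc : lead_coef omegaI = lead_coef omegaJ.
  by apply/le_anti; rewrite lc1 // lc2.
split=> // i li.
(* At the common degree these are the leading coefficients; above it both are zero. *)
have Ei : omegaI`_i = omegaJ`_i.
  have [->|ne] := eqVneq (i : nat) (size omegaI).-1.
    by rewrite {2}sz -!lead_coefE.
  have le : (size omegaI <= i)%N.
    by move: li ne; case: (size omegaI) => // s /= si ne; rewrite ltn_neqAle eq_sym ne.
  by rewrite !nth_default // -sz.
(* Both coefficients carry the same nonzero factor, the leading coefficient of [binpoly i], which is
   cancelled. *)
have := Ei; rewrite (binpoly_coef EI li) (binpoly_coef (i := i) EJ) -?sz //.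
move/mulIf => /(_ _)/eqP; rewrite eqr_int => /(_ _)/eqP; apply.
by rewrite lead_coef_eq0 -size_poly_eq0 size_binpoly.
Qed.
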